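(* Let $Q_n$ be the number of rooted planar quadrangulations (without boundary) with $n$ vertices, and let $\mathfrak{Q}(x)=\sum_{n\geq 2}Q_n x^n$ and $\mathfrak{Q}^{\bullet}(x)=x\,\mathfrak{Q}'(x)$. Then, as formal power series in $x$, $$\mathfrak{Q}^{\bullet}=2x^2+6x\left(\frac{\mathfrak{Q}^{\bullet}-\mathfrak{Q}}{1-\mathfrak{Q}^{\bullet}/x}\right).$$ This equation characterizes $\mathfrak{Q}$ (i.e. $\mathfrak{Q}$ is its unique solution in $x^2\mathbb{Q}[[x]]$), and it is equivalent to the following recursion: $Q_2=1$ and, for every $n\geq 3$, $$n\,Q_n=\sum_{k=2}^{n-1}k\,(n+1-k)\,Q_k\,Q_{n+1-k}+(4n-10)\,Q_{n-1}.$$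
   Context: A planar map is a finite connected graph (loops and multiple edges allowed) properly embedded in the two-dimensional sphere, considered up to continuous (orientation-preserving) deformation. It is rooted if an oriented edge is distinguished. The degree of a face is the number of edges incident to it, i.e. the number of sides of its underlying polygon (an edge with the same face on both sides is counted twice). A (rooted, planar) quadrangulation is a rooted planar map all of whose faces have degree $4$. By convention, the map consisting of two vertices linked by a single edge is considered to be a quadrangulation without boundary (with $0$ faces), so that $Q_2=1$; the series starts $\mathfrak{Q}(x)=x^2+2x^3+9x^4+54x^5+378x^6+\cdots$. For a series in $x^2\mathbb{Q}[[x]]$, the series $\mathfrak{Q}^{\bullet}/x$ has zero constant term, so $1-\mathfrak{Q}^{\bullet}/x$ is invertible in $\mathbb{Q}[[x]]$. *)

(* Defs.v *)
From HB Require Import structures.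
From mathcomp Require Import all_boot all_order all_algebra all_fingroup.
From mathcomp Require Import boolp zify.

Set Implicit Arguments.
Unset Strict Implicit.
Unset Printing Implicit Defensive.

Import GRing.Theory.
Local Open Scope ring_scope.

(* * Formal power series over a field *)

Record fps (R : fieldType) := Fps { fps_coef :> nat -> R }.

HB.instance Definition _ (R : fieldType) := gen_eqMixin (fps R).
HB.instance Definition _ (R : fieldType) := gen_choiceMixin (fps R).

Section FpsRing.
Variable R : fieldType.
Implicit Types f g h : fps R.

Lemma fpsP f g : (forall n, f n = g n) -> f = g.
Proof. by case: f g => [f] [g] /= fg; congr Fps; apply: funext. Qed.

Definition fps_zero : fps R := Fps (fun=> 0).
Definition fps_one : fps R := Fps (fun n => (n == 0%N)%:R).
Definition fps_opp f := Fps (fun n => - f n).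
Definition fps_add f g := Fps (fun n => f n + g n).
Definition fps_mul f g := Fps (fun n => \sum_(i < n.+1) f i * g (n - i)%N).

Fact fps_addA : associative fps_add.
Proof. by move=> f g h; apply: fpsP => n /=; rewrite addrA. Qed.
Fact fps_addC : commutative fps_add.
Proof. by move=> f g; apply: fpsP => n /=; rewrite addrC. Qed.
Fact fps_add0 : left_id fps_zero fps_add.
Proof. by move=> f; apply: fpsP => n /=; rewrite add0r. Qed.
Fact fps_addN : left_inverse fps_zero fps_opp fps_add.
Proof. by move=> f; apply: fpsP => n /=; rewrite addNr. Qed.

HB.instance Definition _ :=
  GRing.isZmodule.Build (fps R) fps_addA fps_addC fps_add0 fps_addN.

Let trunc m f : {poly R} := \poly_(i < m) f i.

Let fps_mul_trunc m f g n : (n < m)%N ->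
  fps_mul f g n = (trunc m f * trunc m g)`_n.
Proof.
move=> lt_nm; rewrite coefM; apply: eq_bigr => i _; rewrite !coef_poly.
by rewrite !(leq_ltn_trans _ lt_nm) ?leq_subr // -ltnS.
Qed.

Let coefM_eq (p q r s : {poly R}) n :
    (forall i, (i <= n)%N -> p`_i = q`_i) ->
    (forall i, (i <= n)%N -> r`_i = s`_i) ->
  (p * r)`_n = (q * s)`_n.
Proof.
move=> pq rs; rewrite !coefM; apply: eq_bigr => i _.
by rewrite pq ?rs ?leq_subr // -ltnS.
Qed.

Let trunc_mul m f g i : (i < m)%N ->
  (trunc m (fps_mul f g))`_i = (trunc m f * trunc m g)`_i.
Proof. by move=> lt_im; rewrite coef_poly lt_im (fps_mul_trunc _ _ lt_im). Qed.

Fact fps_mulA : associative fps_mul.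
Proof.
move=> f g h; apply: fpsP => n; rewrite !(@fps_mul_trunc n.+1) //.
transitivity (trunc n.+1 f * trunc n.+1 g * trunc n.+1 h)`_n.
  by rewrite -mulrA; apply: coefM_eq => // i le_in; rewrite trunc_mul.
by apply: coefM_eq => // i le_in; rewrite trunc_mul.
Qed.
Fact fps_mulC : commutative fps_mul.
Proof.
by move=> f g; apply: fpsP => n; rewrite !(@fps_mul_trunc n.+1) // mulrC.
Qed.
Fact fps_mul1 : left_id fps_one fps_mul.
Proof.
move=> f; apply: fpsP => n /=; rewrite big_ord_recl /= mul1r subn0.
by rewrite big1 ?addr0 // => i _; rewrite mul0r.
Qed.
Fact fps_mulDl : left_distributive fps_mul fps_add.
Proof.
move=> f g h; apply: fpsP => n /=; rewrite -big_split /=.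
by apply: eq_bigr => i _; rewrite mulrDl.
Qed.
Fact fps_one_neq0 : fps_one != 0.
Proof.
by apply/eqP => /(congr1 (fun f : fps R => f 0%N)) /eqP; rewrite /= oner_eq0.
Qed.

HB.instance Definition _ := GRing.Zmodule_isComNzRing.Build (fps R)
  fps_mulA fps_mulC fps_mul1 fps_mulDl fps_one_neq0.

(* The first n coefficients of 1 / f, obtained by solving f * (1 / f) = 1. *)
Fixpoint fps_inv_seq f n : seq R :=
  if n is m.+1 then
    let s := fps_inv_seq f m in
    rcons s ((f 0%N)^-1 * ((m == 0%N)%:R - \sum_(i < m) f (m - i)%N * s`_i))
  else [::].

Definition fps_unit : pred (fps R) := fun f => f 0%N != 0.
Definition fps_inv f :=
  if fps_unit f then Fps (fun n => (fps_inv_seq f n.+1)`_n) else f.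

Let size_inv_seq f n : size (fps_inv_seq f n) = n.
Proof. by elim: n => //= n IHn; rewrite size_rcons IHn. Qed.

Let nth_inv_seq f n i : (i < n)%N ->
  (fps_inv_seq f n)`_i = (fps_inv_seq f i.+1)`_i.
Proof.
elim: n => // n IHn; rewrite ltnS leq_eqVlt => /predU1P[-> // | lt_in].
by rewrite [LHS]/= nth_rcons size_inv_seq lt_in IHn.
Qed.

Fact fps_mulV : {in fps_unit, left_inverse 1 fps_inv *%R}.
Proof.
move=> f f0; rewrite /fps_inv ifT // mulrC; apply: fpsP => n.
change (\sum_(i < n.+1) f i * (fps_inv_seq f (n - i).+1)`_(n - i) =
        (n == 0%N)%:R).
rewrite big_ord_recl /= subn0 nth_rcons size_inv_seq ltnn eqxx.
rewrite mulrA mulfV // mul1r -addrA [X in _ + X](_ : _ = 0) ?addr0 //.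
apply/eqP; rewrite addrC subr_eq0; apply/eqP.
rewrite [RHS](reindex_inj rev_ord_inj) /=; apply: eq_bigr => i _.
rewrite subKn // nth_rcons size_inv_seq ltnn eqxx.
rewrite (@nth_inv_seq f n (n - i.+1)) ?ltn_subrL ?(leq_trans _ (ltn_ord i)) //.
by rewrite /= nth_rcons size_inv_seq ltnn eqxx.
Qed.

Fact fps_unitP f g : g * f = 1 -> fps_unit f.
Proof.
move/(congr1 (fun h : fps R => h 0%N)); rewrite /= big_ord1 /= => gf.
by apply/eqP => f0; move/eqP: gf; rewrite f0 mulr0 eq_sym oner_eq0.
Qed.
Fact fps_inv_out : {in [predC fps_unit], fps_inv =1 id}.
Proof. by move=> f; rewrite inE /= /fps_inv => /negPf nuf; rewrite ifF. Qed.

HB.instance Definition _ := GRing.ComNzRing_hasMulInverse.Build (fps R)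
  fps_mulV fps_unitP fps_inv_out.

Definition fps_X : fps R := Fps (fun n => (n == 1%N)%:R).

Definition fps_deriv f : fps R := Fps (fun n => n.+1%:R * f n.+1).

(* f / x; meaningful when f has zero constant term, see fps_divXK. *)
Definition fps_divX f : fps R := Fps (fun n => f n.+1).

Lemma fps_divXK f : f 0%N = 0 -> fps_X * fps_divX f = f.
Proof.
move=> f0; apply: fpsP => -[|n]; first by rewrite /= big_ord1 mul0r f0.
change (\sum_(i < n.+2) fps_X i * fps_divX f (n.+1 - i)%N = f n.+1).
rewrite !big_ord_recl /= mul0r add0r mul1r subn1 /=.
by rewrite big1 ?addr0 // => i _; rewrite mul0r.
Qed.

Lemma fps_unitE f : (f \is a GRing.unit) = (f 0%N != 0).
Proof. by []. Qed.

End FpsRing.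

Arguments fps_X {R}.

(* * Rooted planar maps *)

(* A map is encoded by its rotation system on the finite type D of its darts
   (oriented edges): the first permutation sends a dart to the next one
   counterclockwise around its origin, the second one reverses darts, and the
   last component is the root. *)
Definition rmap (D : finType) : finType := ({perm D} * {perm D} * D)%type.

Section RootedMaps.
Variable D : finType.
Implicit Types m : rmap D.

Definition map_next m : {perm D} := m.1.1.
Definition map_rev m : {perm D} := m.1.2.
Definition map_root m : D := m.2.

(* Its cycles are the boundary walks of the faces: d is followed by the dart
   next to its reverse around the endpoint of d. *)
Definition map_face m : {perm D} := (map_rev m * map_next m)%g.

Definition vertices m := porbits (map_next m).
Definition edges m := porbits (map_rev m).
Definition faces m := porbits (map_face m).

Definition is_map m :=
  [forall d, (map_rev m (map_rev m d) == d) && (map_rev m d != d)].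

Definition map_connected m :=
  [forall d1, forall d2,
    connect [rel x y | (y == map_next m x) || (y == map_rev m x)] d1 d2].

(* Embedded in the sphere: Euler characteristic 2. *)
Definition planar_map m :=
  [&& is_map m, map_connected m & #|vertices m| + #|faces m| == #|edges m| + 2]%N.

(* The degree of a face is the number of its sides, i.e. of darts in its cycle.
   The second disjunct is the conventional quadrangulation without faces. *)
Definition quadrangulation m :=
  planar_map m &&
  ([forall f in faces m, #|f| == 4] ||
   (#|vertices m| == 2) && (#|edges m| == 1))%N.

(* Equality of rooted maps up to orientation-preserving homeomorphism. *)
Definition rmap_iso : rel (rmap D) := fun m1 m2 =>
  [exists s : {perm D},
    [&& [forall d, s (map_next m1 d) == map_next m2 (s d)],
        [forall d, s (map_rev m1 d) == map_rev m2 (s d)] &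
        s (map_root m1) == map_root m2]].

Lemma rmap_iso_equiv : equivalence_rel rmap_iso.
Proof.
have refl : reflexive rmap_iso.
  move=> m; apply/existsP; exists 1%g; rewrite perm1 eqxx andbT.
  by apply/andP; split; apply/forallP => d; rewrite !perm1.
have sym : forall m1 m2, rmap_iso m1 m2 -> rmap_iso m2 m1.
  move=> m1 m2 /existsP[s /and3P[/forallP sn /forallP sr /eqP s0]].
  apply/existsP; exists s^-1%g; rewrite -s0 permK eqxx andbT.
  apply/andP; split; apply/forallP => d; apply/eqP/(@perm_inj _ s).
    by rewrite (eqP (sn _)) !permKV.
  by rewrite (eqP (sr _)) !permKV.
have trans : transitive rmap_iso.
  move=> m2 m1 m3 /existsP[s /and3P[/forallP sn /forallP sr /eqP s0]].
  move=> /existsP[t /and3P[/forallP tn /forallP tr /eqP t0]].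
  apply/existsP; exists (s * t)%g; rewrite permM s0 t0 eqxx andbT.
  apply/andP; split; apply/forallP => d; rewrite !permM.
    by rewrite (eqP (sn _)) (eqP (tn _)).
  by rewrite (eqP (sr _)) (eqP (tr _)).
move=> m1 m2 m3; split; first exact: refl.
move=> iso12; apply/idP/idP; last exact: trans.
by apply: trans; apply: sym.
Qed.

Let card_porbits (s : {perm D}) k :
  (forall d, #|porbit s d| = k) -> (#|porbits s| * k)%N = #|D|.
Proof.
move=> sk; suff -> : #|D| = (\sum_(A in porbits s) #|A|)%N.
  rewrite (eq_bigr (fun=> k)) ?sum_nat_const // => A.
  by case/imsetP=> d _ ->.
rewrite -cardsT (card_partition (P := porbits s)) //.
apply/and3P; split.
- apply/eqP/setP => d; rewrite inE; apply/bigcupP.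
  by exists (porbit s d); rewrite ?porbit_id // imset_f.
- apply/trivIsetP => _ _ /imsetP[x _ ->] /imsetP[y _ ->].
  apply: contraR => /pred0Pn[z /andP[/= xz yz]].
  by move: xz yz; rewrite -!eq_porbit_mem => /eqP -> /eqP ->.
- apply/imsetP=> -[d _ /setP/(_ d)].
  by rewrite porbit_id inE.
Qed.

Lemma card_edges m : is_map m -> (#|edges m| * 2)%N = #|D|.
Proof.
move=> /forallP rev_m; apply: card_porbits => d.
have /andP[/eqP revK rev_d] := rev_m d.
suff -> : porbit (map_rev m) d = [set d; map_rev m d].
  by rewrite cards2 eq_sym rev_d.
apply/setP => d'; rewrite !inE; apply/porbitP/orP => [[i ->] | ].
  elim: i => [|i IHi]; first by left; rewrite expg0 perm1.
  by rewrite expgSr permM; case: IHi => /eqP ->; [right | left; rewrite revK].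
case=> /eqP ->; first by exists 0%N; rewrite expg0 perm1.
by exists 1%N; rewrite expg1.
Qed.

Lemma quadrangulation_edges m :
  quadrangulation m -> (#|edges m| < #|vertices m| * 2)%N.
Proof.
case/andP=> /and3P[mapm _ /eqP euler].
case/orP=> [/forall_inP f4 | /andP[/eqP -> /eqP -> //]].
have /card_porbits: forall d, #|porbit (map_face m) d| = 4%N.
  by move=> d; apply/eqP/f4/imset_f.
rewrite -(card_edges mapm) -/(faces m); lia.
Qed.

End RootedMaps.

(* The number of rooted quadrangulations with n vertices, up to isomorphism.
   The sum is over the number e of edges, the darts being labelled by
   'I_(e.*2); quadrangulation_edges shows that the bound e < n.*2 loses none. *)
Definition nb_quadrangulations (n : nat) : nat :=
  \sum_(e < n.*2) #|equivalence_partition (@rmap_iso 'I_(e.*2))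
                     [set m | quadrangulation m & #|vertices m| == n]|.

(* * The generating function *)

Definition quad_series : fps rat :=
  Fps (fun n => if (2 <= n)%N then (nb_quadrangulations n)%:R else 0).

(* x F'(x), written with a bullet exponent for F = quad_series. *)
Definition pointed (F : fps rat) : fps rat := fps_X * fps_deriv F.

Definition quad_equation (F : fps rat) : Prop :=
  pointed F = 2%:R * fps_X ^+ 2
    + 6%:R * fps_X * ((pointed F - F) / (1 - fps_divX (pointed F))).

Definition quad_recursion (a : nat -> rat) : Prop :=
  a 2%N = 1 /\
  forall n, (3 <= n)%N ->
    n%:R * a n =
      \sum_(2 <= k < n) k%:R * (n.+1 - k)%:R * a k * a (n.+1 - k)%N
      + (4 * n - 10)%:R * a n.-1.

(* F belongs to x^2 Q[[x]]. *)
Definition in_x2 (F : fps rat) : Prop := F 0%N = 0 /\ F 1%N = 0.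

(* Main.v *)
(** Delete the root edge, following Tutte: a map all of whose inner faces are
quadrangles and whose root face has degree 2p either falls apart into two such
maps, or loses an inner face while its root face grows to degree 2p+2. Repeating
this encodes the maps by trees. On rotation systems the darts are kept: removing
the edge {x, y} multiplies both the reversal and the face permutation by the
transposition (x y), so that the vertex permutation does not change, the darts
x and y become fixed points of the reversal, and the number of faces changes
by one. That a planar map falls apart when its root edge has the same face on
both sides is the equality case of Euler's inequality.

If W_p is the generating function by the number of inner faces, the deletion gives
W_{p+1} = sum_{i+j=p} W_i W_j + x W_{p+2}, which together with W_0 = 1 has the
unique solution W_p = r^{p+1} ((1 - 2xr) c_p - x r c_{p+1}), where the c_p are the
Catalan numbers and r = 1 + 3xr^2. Hence Q = x^2 W_1 = (xr)^2 - 4(xr)^3, and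
Q^bullet = 2 x^2 r, from which the equation follows by algebra. *)

From HB Require Import structures.
From mathcomp Require Import all_boot all_order all_algebra all_fingroup.
From mathcomp Require Import boolp zify ring.
Require Import Defs.

Set Implicit Arguments.
Unset Strict Implicit.
Unset Printing Implicit Defensive.

Import GRing.Theory Num.Theory.

(** * Removing an edge from a rotation system *)

(** Deleting an edge leaves the class of connected maps without fixed darts. So the dart type never
    changes, the reversal is an arbitrary involution, and planarity becomes V + F = E + 2K, with K
    the number of components; this equality is what passes through the induction. Labels do not
    survive in a tree, but the list of darts in deletion order does the job: it matches the darts of
    any two maps with the same tree, so that isomorphism classes can be counted as trees. The root
    face grows when an inner face is lost, hence recursions on f inner faces and half-perimeter p
    run on 2f + p. A quadrangulation with n + 2 vertices, n >= 1, has n faces. Seen as a disc it has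
    p = 2 and n - 1 inner faces, which is what deleting the root edge makes of a disc with p = 1 and
    n inner faces. This is why W_1 counts quadrangulations, with the conventional single edge as its
    constant term. *)

Lemma cat_cons_inj (T : eqType) (x : T) a b a' b' :
  x \notin a -> x \notin a' -> a ++ x :: b = a' ++ x :: b' -> a = a' /\ b = b'.
Proof.
elim: a a' => [|u a IHa] [|v a'] /=.
- by move=> _ _ [].
- by rewrite inE negb_or => _ /andP[/eqP xv _] [].
- by rewrite inE negb_or => /andP[/eqP xv _] _ [/esym].
rewrite !inE !negb_or => /andP[_ xa] /andP[_ xa'] [-> ab].
by have [-> ->] := IHa _ xa xa' ab.
Qed.

Lemma filter_cons_cat (T : eqType) (p : pred T) c x w :
  filter p c = x :: w -> exists a b,
  [/\ c = a ++ x :: b, p x, filter p a = [::] & filter p b = w].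
Proof.
elim: c => //= u c IHc; case: ifP => [pu [<- <-] | pu /IHc].
  by exists [::], c.
by case=> a [b [-> px fa <-]]; exists (u :: a), b; rewrite /= pu.
Qed.

(** * Cutting and joining cycles by a transposition *)

Section Cycles.
Variable D : finType.
Implicit Types (s : {perm D}) (c : seq D) (x y : D).

Lemma porbit_fcycle s c x : fcycle s c -> x \in c -> porbit s x =i c.
Proof.
move=> cc xc y; apply/porbitP/idP => [[i ->] | yc].
  elim: i => [|i IHi]; first by rewrite expg0 perm1.
  by rewrite expgSr permM (mem_fcycle cc).
have [i p def] := rot_to xc.
have: y \in x :: p by rewrite -def mem_rot.
have: fcycle s (x :: p) by rewrite -def rot_cycle.
move/fcycle_consE=> ->; case/trajectP => j _ ->.
by exists j; elim: j => [|j IHj]; rewrite ?expg0 ?perm1 // expgSr permM -IHj.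
Qed.

(** Composition applies the transposition first, so only the sources of the steps have to avoid [x]
    and [y]. The endpoint [u] may be one of them, which is how the new cycles close up. *)
Lemma fpath_tperm s x y z c u : x \notin z :: c -> y \notin z :: c ->
  path (frel (tperm x y * s)%g) z (rcons c u) = path (frel s) z (rcons c u).
Proof.
elim: c z => [|v c IHc] z; rewrite !(inE, negb_or, andbT) /=.
  by move=> xz yz; rewrite permM tpermD.
case/and3P=> [xz xv xc] /and3P[yz yv yc].
rewrite permM tpermD //.
by rewrite IHc // inE negb_or ?xv ?yv.
Qed.

Lemma fpath_tpermR s x y c u : x \notin c -> y \notin c ->
  path (frel (tperm x y * s)%g) y (rcons c u) = path (frel s) x (rcons c u).
Proof.
case: c => [|v c] xc yc /=; first by rewrite permM tpermR.
by rewrite fpath_tperm // permM tpermR.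
Qed.

Lemma fcycle_split s x y a b : uniq (x :: a ++ y :: b) ->
  fcycle s (x :: a ++ y :: b) ->
  fcycle (tperm x y * s)%g (y :: a) /\ fcycle (tperm x y * s)%g (x :: b).
Proof.
rewrite cons_uniq mem_cat inE cat_uniq /= !negb_or.
case/and5P=> [/and3P[xa xy xb] _ /andP[ya _] yb _].
rewrite rcons_cat -cat_rcons cat_path last_rcons.
case/andP=> pa pb; split; first by rewrite /= fpath_tpermR.
by rewrite tpermC /= fpath_tpermR.
Qed.

Lemma fcycle_merge s x y a b : uniq (x :: a ++ y :: b) ->
  fcycle s (x :: a) -> fcycle s (y :: b) ->
  fcycle (tperm x y * s)%g (x :: b ++ y :: a).
Proof.
rewrite cons_uniq mem_cat inE cat_uniq /= !negb_or.
case/and5P=> [/and3P[xa xy xb] _ /andP[ya _] yb _] pa pb.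
rewrite rcons_cat -cat_rcons cat_path last_rcons.
by rewrite fpath_tpermR // pa tpermC fpath_tpermR ?pb.
Qed.

Lemma card_porbits_split s x y : x != y -> y \in porbit s x ->
  #|porbits (tperm x y * s)%g| = #|porbits s|.+1.
Proof.
move=> xy ys; have := porbits_mul_tperm s x y.
by rewrite /= xy porbit_sym ys addn0 addn1.
Qed.

Lemma card_porbits_merge s x y : x != y -> y \notin porbit s x ->
  #|porbits (tperm x y * s)%g|.+1 = #|porbits s|.
Proof.
move=> xy ys; have := porbits_mul_tperm s x y.
by rewrite /= xy porbit_sym ys; lia.
Qed.

End Cycles.

Section Removal.
Variable D : finType.
Implicit Types (al ph : {perm D}) (x y : D).

(* Deleted edges are kept as pairs of fixed points of the reversal [al]. *)
Definition alive al := [set x | al x != x].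

Lemma rm_edgeE al x y : involutive al -> al x = y -> x != y ->
  forall z, (tperm x y * al)%g z = if (z == x) || (z == y) then z else al z.
Proof.
move=> alK xy neq_xy z; rewrite permM; case: tpermP => [->|->|/eqP zx /eqP zy].
- by rewrite eqxx -xy alK.
- by rewrite eqxx orbT.
by rewrite (negPf zx) (negPf zy).
Qed.

Lemma rm_edgeK al x y : involutive al -> al x = y -> x != y ->
  involutive (tperm x y * al)%g.
Proof.
move=> alK xy neq z; rewrite !(rm_edgeE alK xy neq).
case: (boolP ((z == x) || _)) => [/= -> // | /norP[zx]]; rewrite -xy => zy /=.
have -> : (al z == x) = false by apply/eqP => E; rewrite -E alK eqxx in zy.
by rewrite (inj_eq perm_inj) (negPf zx) alK.
Qed.

Lemma alive_rm_edge al x y : involutive al -> al x = y -> x != y ->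
  alive (tperm x y * al)%g = alive al :\ x :\ y.
Proof.
move=> alK xy neq; apply/setP => z; rewrite !inE (rm_edgeE alK xy neq).
by case: (z == x) (z == y) => [] []; rewrite /= ?eqxx.
Qed.

(** As [al] exchanges [x] and [y], it commutes with their transposition, and the two copies
    cancel. *)
Lemma rm_edge_vertex al ph x y : involutive al -> al x = y ->
  ((tperm x y * al) * (tperm x y * ph) = al * ph)%g.
Proof.
move=> alK xy; apply/permP => z; rewrite !permM; congr (ph _).
have yx : al y = x by rewrite -xy alK.
case: (tpermP x y z) => [->|->|zx zy]; rewrite ?xy ?yx ?tpermL ?tpermR //.
by rewrite tpermD //; apply/eqP => E; [apply: zy | apply: zx];
   rewrite -[z]alK -E.
Qed.

End Removal.

(** * Connected components of a rotation system and Euler's inequality *)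

Section Components.
Variable D : finType.
Implicit Types (al sg ph : {perm D}) (x y : D).

Definition linked al sg := connect [rel x y | (y == sg x) || (y == al x)].

Definition component al sg x := [set y | linked al sg x y].

Definition components al sg := [set component al sg x | x : D].

Lemma linked_refl al sg x : linked al sg x x.
Proof. exact: connect0. Qed.

Lemma linked_trans al sg : transitive (linked al sg).
Proof. exact: connect_trans. Qed.

Lemma linked_next al sg x : linked al sg x (sg x).
Proof. by apply: connect1; rewrite /= eqxx. Qed.

Lemma linked_rev al sg x : linked al sg x (al x).
Proof. by apply: connect1; rewrite /= eqxx orbT. Qed.

Lemma linked_face al sg x : linked al sg x ((al * sg)%g x).
Proof.
by rewrite permM; apply: linked_trans (linked_rev _ _ _) (linked_next _ _ _).
Qed.

Lemma linked_sub al sg al' sg' :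
  (forall x, linked al' sg' x (sg x)) -> (forall x, linked al' sg' x (al x)) ->
  forall x y, linked al sg x y -> linked al' sg' x y.
Proof.
by move=> lsg lal; apply: connect_sub => x y /= /orP[] /eqP ->;
   [apply: lsg | apply: lal].
Qed.

(** The steps are directed, but the inverse of a permutation of a finite set is one of its
    powers. *)
Lemma linked_sym al sg : symmetric (linked al sg).
Proof.
suff imp x y : linked al sg x y -> linked al sg y x.
  by move=> x y; apply/idP/idP; apply: imp.
case/connectP=> p; elim: p x => [|z p IHp] x /=.
  by move=> _ ->; apply: linked_refl.
case/andP=> xz /IHp{}IHp /IHp yz; apply: linked_trans yz _.
have back (f : {perm D}) u : (forall v, linked al sg v (f v)) ->
    linked al sg (f u) u.
  move=> link_f; have: fconnect f (f u) u.
    by rewrite fconnect_sym ?fconnect1 //; apply: perm_inj.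
  by apply: connect_sub => v _ /eqP <-; apply: link_f.
by case/orP: xz => /eqP ->; apply: back => v;
   [apply: linked_next | apply: linked_rev].
Qed.

Lemma linked_porbit al sg x y : y \in porbit (al * sg)%g x -> linked al sg x y.
Proof.
case/porbitP=> i ->; elim: i => [|i IHi]; first by rewrite perm1 linked_refl.
by rewrite expgSr permM; apply: linked_trans IHi (linked_face _ _ _).
Qed.

Lemma linked_fcycle al sg c x y :
  fcycle (al * sg)%g c -> x \in c -> y \in c -> linked al sg x y.
Proof.
by move=> cc xc yc; apply: linked_porbit; rewrite (porbit_fcycle cc xc).
Qed.

Lemma linked_closed al sg (P : pred D) x y :
  (forall z, P z -> P (al z)) -> (forall z, P z -> P (sg z)) ->
  linked al sg x y -> P x -> P y.
Proof.
move=> Pal Psg /connectP[p]; elim: p x => [|z p IHp] x /= => [_ -> //|].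
by case/andP=> /orP[] /eqP -> pz yl Px; apply: IHp pz yl _; auto.
Qed.

Lemma eq_component al sg x y :
  (component al sg x == component al sg y) = linked al sg x y.
Proof.
apply/eqP/idP => [/setP/(_ y) | xy].
  by rewrite !inE linked_refl.
apply/setP => z; rewrite !inE; apply/idP/idP; last exact: linked_trans.
by apply: linked_trans; rewrite linked_sym.
Qed.

Section RemoveEdge.
Variables (al sg : {perm D}) (x y : D).
Hypotheses (alK : involutive al) (xy : al x = y) (neq_xy : x != y).
Let al' := (tperm x y * al)%g.

Lemma linked_rm z t : linked al' sg z t -> linked al sg z t.
Proof.
apply: linked_sub => u; first exact: linked_next.
rewrite (rm_edgeE alK xy neq_xy).
by case: ifP => _; [apply: linked_refl | apply: linked_rev].
Qed.

Lemma linked_rm_eq : linked al' sg x y -> linked al' sg =2 linked al sg.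
Proof.
move=> xy' z t; apply/idP/idP; first exact: linked_rm.
apply: linked_sub => u; first exact: linked_next.
have [-> | ux] := eqVneq u x; first by rewrite xy.
have [-> | uy] := eqVneq u y; first by rewrite -xy alK linked_sym xy.
have := linked_rev al' sg u.
by rewrite (rm_edgeE alK xy neq_xy) (negPf ux) (negPf uy).
Qed.

Lemma card_components_rm_eq : linked al' sg x y ->
  #|components al' sg| = #|components al sg|.
Proof.
move=> xy'; congr #|pred_of_set _|; apply: eq_imset => z.
by apply/setP => t; rewrite !inE linked_rm_eq.
Qed.

Lemma linked_rm_or z : linked al sg x z ->
  linked al' sg x z || linked al' sg y z.
Proof.
move=> xz; pose P t := linked al' sg x t || linked al' sg y t.
apply: (@linked_closed al sg P) xz _; last by rewrite /P linked_refl.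
  move=> t Pt; have [-> | tx] := eqVneq t x.
    by rewrite xy /P linked_refl orbT.
  have [-> | ty] := eqVneq t y; first by rewrite -xy alK /P linked_refl.
  have -> : al t = al' t.
    by rewrite (rm_edgeE alK xy neq_xy) (negPf tx) (negPf ty).
  by case/orP: Pt => /linked_trans/(_ (linked_rev al' sg t)) Pt; apply/orP;
     [left | right].
move=> t; case/orP=> /linked_trans/(_ (linked_next _ _ _)) Pt; apply/orP.
  by left.
by right.
Qed.

Lemma card_components_rm : #|components al' sg| <= #|components al sg|.+1.
Proof.
(* The old component of [x] is replaced by at most two, those of the ends [x] and [y]; every other
   component survives unchanged. *)
have sub : components al' sg \subset
    [set component al' sg x; component al' sg y]
    :|: (components al sg :\ component al sg x).
  apply/subsetP => _ /imsetP[z _ ->]; rewrite !inE.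
  have [xz | xz] := boolP (linked al sg x z).
    have := linked_rm_or xz; rewrite -!eq_component !(eq_sym (component _ _ z)).
    by case/orP=> ->; rewrite ?orbT.
  suff -> : component al' sg z = component al sg z.
    by rewrite eq_component linked_sym xz imset_f // orbT.
  apply/setP => t; rewrite !inE; apply/idP/idP; first exact: linked_rm.
  (* A walk from [z] stays in the old component of [z], so it meets neither [x] nor [y] and uses
     only steps that are still present. *)
  move=> zt; pose P t := linked al' sg z t && linked al sg z t.
  suff: P t by case/andP.
  apply: (@linked_closed al sg P) zt _; last by rewrite /P !linked_refl.
    move=> u /andP[zu' zu].
    have nx v : linked al sg x v -> u != v.
      move=> xv; apply: contraNneq xz => E.
      by rewrite linked_sym (linked_trans zu) // E linked_sym.
    rewrite /P (linked_trans zu (linked_rev _ _ _)) andbT.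
    apply: linked_trans zu' _; have := linked_rev al' sg u.
    rewrite (rm_edgeE alK xy neq_xy) (negPf (nx x _)) ?(negPf (nx y _)) //.
      by rewrite -xy linked_rev.
    by rewrite linked_refl.
  move=> u /andP[zu' zu].
  by rewrite /P !(linked_trans _ (linked_next _ _ _)).
apply: leq_trans (subset_leq_card sub) _.
have xin : component al sg x \in components al sg by apply: imset_f.
have := cardsD1 (component al sg x) (components al sg); rewrite xin /=.
have := cardsU [set component al' sg x; component al' sg y]
               (components al sg :\ component al sg x).
by rewrite cards2 => -> ->; apply: leq_trans (leq_subr _ _) _; case: (_ != _).
Qed.

End RemoveEdge.

Lemma card_alive_rm al x y k : involutive al -> al x = y -> x != y ->
  #|alive al| = k.+1.*2 -> #|alive (tperm x y * al)%g| = k.*2.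
Proof.
move=> alK xy neq; rewrite alive_rm_edge // => alk.
have xa : x \in alive al by rewrite inE xy eq_sym.
have ya : y \in alive al :\ x by rewrite !inE -xy alK xy neq eq_sym neq.
by move: alk; rewrite (cardsD1 x) xa (cardsD1 y) ya doubleS => -[].
Qed.

Lemma alive0 al : #|alive al| = 0 -> al = 1%g.
Proof.
move=> /cards0_eq/setP al0; apply/permP => z; rewrite perm1.
by have := al0 z; rewrite !inE => /negbFE/eqP.
Qed.

(** The base case of Euler's inequality: without edges, the vertices are both the faces and the
    components. *)
Lemma components1 sg : #|components 1%g sg| = #|porbits sg|.
Proof.
congr #|pred_of_set _|; apply: eq_imset => x; apply/setP => y; rewrite inE.
apply/idP/porbitP => [|[i ->]].
  case/connectP=> p; elim: p x => [|z p IHp] x /= => [_ -> |].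
    by exists 0; rewrite expg0 perm1.
  case/andP=> /orP[] /eqP -> pz yl; have [i ->] := IHp _ pz yl.
    by exists i.+1; rewrite expgS permM.
  by exists i; rewrite perm1.
elim: i => [|i IHi]; first by rewrite perm1 linked_refl.
by rewrite expgSr permM (linked_trans IHi) ?linked_next.
Qed.

Lemma alive_ex al k : #|alive al| = k.+1.*2 -> exists x, x \in alive al.
Proof.
by move=> alk; have /card_gt0P[x] : 0 < #|alive al|; [rewrite alk | exists x].
Qed.

(* The genus of each component is nonnegative: removing an edge merges two
   faces of the same component, or splits a face and adds at most one
   component. *)
Lemma euler_le k al sg : involutive al -> #|alive al| = k.*2 ->
  #|porbits sg| + #|porbits (al * sg)%g| <= k + #|components al sg|.*2.
Proof.
elim: k al => [|k IHk] al alK alk.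
  by rewrite (alive0 alk) mul1g components1 addnn.
have [x] := alive_ex alk; rewrite inE eq_sym.
have [y xy] : {y | al x = y} by exists (al x).
rewrite xy => neq.
have := IHk _ (rm_edgeK alK xy neq) (card_alive_rm alK xy neq alk).
rewrite -mulgA.
have [ys | ys] := boolP (y \in porbit (al * sg)%g x).
  have := card_porbits_split neq ys.
  by have := card_components_rm sg alK xy neq; set A := #|porbits (_ * _)%g|; lia.
have := card_porbits_merge neq ys.
suff /(card_components_rm_eq alK xy neq) -> : linked (tperm x y * al)%g sg x y.
  by set A := #|porbits (_ * _)%g|; lia.
(* Multiplying by the transposition again restores the original face permutation, which has one
   cycle more. The counting formula thus forces [x] and [y] into a common cycle of the merged
   permutation. *)
apply: linked_porbit; rewrite porbit_sym -mulgA.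
have := porbits_mul_tperm (tperm x y * (al * sg))%g x y.
rewrite /= mulgA tperm2 mul1g neq => E1; have := card_porbits_merge neq ys.
by move: E1; case: (x \in _) => //=; set A := #|porbits (_ * _)%g|; lia.
Qed.

End Components.

(** * Gluings encoded by trees *)

(** [Bridge] stands for a root edge with the root face on both sides, with one subtree for each
    part; [Quad] for a root edge between the root face and an inner quadrangle. *)
Inductive tutte_tree :=
  | Vertex
  | Bridge (a b : tutte_tree)
  | Quad (a : tutte_tree).

(** In a map realizing the tree this is the number of vertices minus one; see [encodes_ex]. *)
Fixpoint nb_bridges t :=
  match t with
  | Vertex => 0
  | Bridge a b => (nb_bridges a + nb_bridges b).+1
  | Quad a => nb_bridges a
  end.

Fixpoint nb_quads t :=
  match t with
  | Vertex => 0
  | Bridge a b => nb_quads a + nb_quads b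
  | Quad a => (nb_quads a).+1
  end.

(** The subtree of [Quad] describes the map after deletion, whose root face is longer by two sides;
    hence the predecessor, and the bound in [valid] that keeps it positive. *)
Fixpoint half_perimeter t :=
  match t with
  | Vertex => 0
  | Bridge a b => (half_perimeter a + half_perimeter b).+1
  | Quad a => (half_perimeter a).-1
  end.

Fixpoint valid t :=
  match t with
  | Vertex => true
  | Bridge a b => valid a && valid b
  | Quad a => (1 < half_perimeter a) && valid a
  end.

(** Both sides count edges: on the left one per deletion, on the right half the sides of all faces,
    4f + 2p. So f and p determine the number of darts. *)
Lemma nb_edges_valid t : valid t ->
  nb_bridges t + nb_quads t = (nb_quads t).*2 + half_perimeter t.
Proof.
elim: t => //= [a IHa b IHb /andP[/IHa + /IHb] | a IHa /andP[ha /IHa]]; lia.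
Qed.

(* [glued al ph t l w]: for the edge reversal [al] and the face permutation [ph],
   the tree [t] records the deletion of all edges enclosed by a root face with
   boundary word [w], and [l] lists the darts in the order of their deletion. *)
Inductive glued (D : eqType) (al ph : D -> D) :
    tutte_tree -> seq D -> seq D -> Prop :=
  | GluedVertex : glued al ph Vertex [::] [::]
  | GluedBridge a b la lb wa wb x y : al x = y -> al y = x ->
      glued al ph a la wa -> glued al ph b lb wb ->
      glued al ph (Bridge a b) (x :: y :: la ++ lb) (x :: wa ++ y :: wb)
  | GluedQuad a l w x y z1 z2 z3 : al x = y -> al y = x ->
      ph y = z1 -> ph z1 = z2 -> ph z2 = z3 -> ph z3 = y ->
      glued al ph a l [:: z1, z2, z3 & w] ->
      glued al ph (Quad a) (x :: y :: l) (x :: w).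

Section Glued.
Variable D : eqType.
Implicit Types (al ph : D -> D) (t : tutte_tree) (l w : seq D).

Lemma glued_size al ph t l w : glued al ph t l w ->
  [/\ valid t, size l = (nb_bridges t + nb_quads t).*2
    & size w = (half_perimeter t).*2].
Proof.
elim=> [//|a b la lb wa wb x y _ _ _ [va sla swa] _ [vb slb swb]
       |a l' w' x y z1 z2 z3 _ _ _ _ _ _ _ [va sl sw]] /=.
  by rewrite va vb !size_cat /= sla slb swa swb; split=> //; lia.
by rewrite va sl; move: sw => /= sw; split; lia.
Qed.

Lemma glued_sub al ph t l w : glued al ph t l w -> {subset w <= l}.
Proof.
elim=> [//|a b la lb wa wb x y _ _ _ sa _ sb
       |a l' w' x y z1 z2 z3 _ _ _ _ _ _ _ sa] u.
  rewrite !(inE, mem_cat) => /or4P[->|/sa->|->|/sb->]; by rewrite ?orbT.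
rewrite !inE => /orP[->//|uw]; rewrite sa ?orbT // !inE uw !orbT //.
Qed.

Lemma glued_eq al ph al' ph' t l w : {in l, al =1 al'} -> {in l, ph =1 ph'} ->
  glued al ph t l w -> glued al' ph' t l w.
Proof.
move=> + + gl; elim: gl => {t l w} [|a b la lb wa wb x y xy yx ga IHa gb IHb
    |a l w x y z1 z2 z3 xy yx yz1 z12 z23 z3y ga IHa] eal eph.
- exact: GluedVertex.
- have sa : {subset la <= [:: x, y & la ++ lb]}.
    by move=> u ua; rewrite !inE mem_cat ua !orbT.
  have sb : {subset lb <= [:: x, y & la ++ lb]}.
    by move=> u ub; rewrite !inE mem_cat ub !orbT.
  apply: GluedBridge; rewrite -?eal ?inE ?eqxx ?orbT //.
    by apply: (IHa _ _) => u /sa; [apply: eal | apply: eph].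
  by apply: (IHb _ _) => u /sb; [apply: eal | apply: eph].
have sa : {subset l <= [:: x, y & l]} by move=> u ua; rewrite !inE ua !orbT.
have [m1 m2 m3] : [/\ z1 \in [:: x, y & l], z2 \in [:: x, y & l]
                    & z3 \in [:: x, y & l]].
  by split; apply/sa/(glued_sub ga); rewrite !inE eqxx ?orbT.
apply: (@GluedQuad _ _ _ _ _ _ _ _ z1 z2 z3);
 rewrite -?eal -?eph // ?m1 ?m2 ?m3 // ?inE ?eqxx ?orbT //.
by apply: (IHa _ _) => u /sa; [apply: eal | apply: eph].
Qed.

(** All darts of [l] are reached from the boundary word by [al] and [ph]; connectedness of the
    realized maps comes from here. *)
Lemma glued_closed al ph (P : pred D) t l w : glued al ph t l w ->
  (forall x, P x -> P (al x)) -> (forall x, P x -> P (ph x)) ->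
  {in w, forall x, P x} -> {in l, forall x, P x}.
Proof.
move=> + Pal Pph; elim=> {t l w} [//|a b la lb wa wb x y xy _ _ IHa _ IHb
    |a l w x y z1 z2 z3 xy _ yz1 z12 z23 _ _ IHa] Pw u.
  have Px : P x by apply: Pw; rewrite mem_head.
  rewrite !(inE, mem_cat) => /or4P[/eqP->//|/eqP->|ua|ub].
  - by rewrite -xy Pal.
  - by apply: IHa ua => v va; apply: Pw; rewrite inE mem_cat va orbT.
  by apply: IHb ub => v vb; apply: Pw; rewrite inE mem_cat inE vb !orbT.
have Px : P x by apply: Pw; rewrite mem_head.
rewrite !inE => /or3P[/eqP->//|/eqP->|ua]; first by rewrite -xy Pal.
apply: IHa ua => v.
have P1 : P z1 by rewrite -yz1 -xy; auto.
have P2 : P z2 by rewrite -z12; auto.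
rewrite !inE => /or4P[/eqP->|/eqP->|/eqP->|vw] //.
  by rewrite -z23; auto.
by apply: Pw; rewrite inE vw orbT.
Qed.

Lemma glued_inv al ph t l w : glued al ph t l w ->
  match t with
  | Vertex => l = [::] /\ w = [::]
  | Bridge a b => exists x y la lb wa wb,
      [/\ l = [:: x, y & la ++ lb], w = x :: wa ++ y :: wb,
          al x = y /\ al y = x,
          glued al ph a la wa & glued al ph b lb wb]
  | Quad a => exists x y l' w' z1 z2 z3,
      [/\ l = [:: x, y & l'], w = x :: w', al x = y /\ al y = x &
          glued al ph a l' [:: z1, z2, z3 & w'] /\
          [/\ ph y = z1, ph z1 = z2, ph z2 = z3 & ph z3 = y]]
  end.
Proof.
case=> {t l w} [//|a b la lb wa wb x y ? ? ? ?|a l w x y z1 z2 z3 ? ? ? ? ? ? ?].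
  by exists x, y, la, lb, wa, wb.
by exists x, y, l, w, z1, z2, z3.
Qed.

(** The first dart [x] of the word determines its reverse [y]. Uniqueness of darts makes [y] occur
    in the rest of the word exactly for a [Bridge], where it marks the only place to cut; for a
    [Quad] the three new sides are iterates of [ph] on [y]. So each step of the deletion is
    forced. *)
Lemma glued_tree_inj al ph t t' l l' w :
  glued al ph t l w -> glued al ph t' l' w -> uniq l -> uniq l' -> t = t'.
Proof.
have mixed y wa wb c l1 w1 z1 z2 z3 : y \notin l1 -> wa ++ y :: wb = w1 ->
    glued al ph c l1 [:: z1, z2, z3 & w1] -> False.
  move=> yl E gc; case/negP: yl; apply: (glued_sub gc).
  by rewrite -E !inE mem_cat mem_head !orbT.
elim: t t' l l' w => [|a IHa b IHb|a IHa] t' l l' w /glued_inv.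
- by case=> _ -> /glued_inv; case: t' => // [a b|a];
     [case=> ? [? [? [? [? [? []]]]]] | case=> ? [? [? [? [? [? [? []]]]]]]].
- case=> x [y [la [lb [wa [wb [-> -> [xy _] ga gb]]]]]] /glued_inv.
  rewrite /= mem_cat !negb_or cat_uniq.
  case: t' => [[]//|a' b'|a'].
    case=> x' [y' [la' [lb' [wa' [wb' [-> [<- E] [xy' _] ga' gb']]]]]] /=.
    rewrite mem_cat !negb_or cat_uniq.
    case/and5P=> [_ /andP[ya _] ula _ ulb] /and5P[_ /andP[ya' _] ula' _ ulb'].
    rewrite -xy' xy in E ya'.
    have [E1 E2] := cat_cons_inj (contra (glued_sub ga (x := y)) ya)
      (contra (glued_sub ga' (x := y)) ya') E.
    rewrite -E1 -E2 in ga' gb'.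
    by rewrite (IHa _ _ _ _ ga ga') // (IHb _ _ _ _ gb gb').
  case=> x' [y' [l1 [w1 [z1 [z2 [z3 [-> [<- E] [xy' _] [ga' _]]]]]]]] _ /and3P[_ yl _].
  by rewrite -xy' xy in yl; case: (mixed _ _ _ _ _ _ _ _ _ yl E ga').
case=> x [y [la [wa [z1 [z2 [z3 [-> -> [xy _] [ga [yz1 z12 z23 _]]]]]]]]] /glued_inv.
case: t' => [[]//|a' b'|a'].
  case=> x' [y' [la' [lb' [wa' [wb' [-> [<- E] [xy' _] ga' gb']]]]]] /and3P[_ yl _] _.
  by rewrite -xy xy' in yl; case: (mixed _ _ _ _ _ _ _ _ _ yl (esym E) ga).
case=> x' [y' [l1 [w1 [u1 [u2 [u3 [-> [<- E] [xy' _] [ga' [E1 E2 E3 _]]]]]]]]].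
have Eu1 : u1 = z1 by rewrite -E1 -xy' xy.
have Eu2 : u2 = z2 by rewrite -E2 Eu1.
have Eu3 : u3 = z3 by rewrite -E3 Eu2.
rewrite Eu1 Eu2 Eu3 -E in ga'.
by case/and3P=> _ _ ul /and3P[_ _ ul']; rewrite (IHa _ _ _ _ ga ga').
Qed.

Lemma glued_uniq al ph t l w : glued al ph t l w -> uniq l -> uniq w.
Proof.
elim=> {t l w} [//|a b la lb wa wb x y _ _ ga IHa gb IHb
    |a l w x y z1 z2 z3 _ _ _ _ _ _ ga IHa] /=.
  rewrite !(inE, mem_cat) !negb_or cat_uniq => /and5P[].
  case/and3P=> xy xa xb /andP[ya yb] ula /hasPn ab ulb.
  rewrite xy cat_uniq IHa //= IHb // (contra (glued_sub ga (x := _)) xa).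
  rewrite negb_or (contra (glued_sub gb (x := _)) xb).
  rewrite (contra (glued_sub ga (x := _)) ya) (contra (glued_sub gb (x := _)) yb) /= andbT.
  apply/hasPn => u /(glued_sub gb)/ab; apply: contra.
  exact: (glued_sub ga).
rewrite inE negb_or => /and3P[/andP[_ xl] _ /IHa /and4P[_ _ _ uw]].
apply/andP; split=> //; apply: contra xl => xw.
by apply: (glued_sub ga); rewrite !inE xw !orbT.
Qed.

Lemma glued_moves al ph t l w : glued al ph t l w -> uniq l ->
  {in l, forall d, al d != d}.
Proof.
elim=> {t l w} [//|a b la lb wa wb x y xy yx _ IHa _ IHb
    |a l w x y z1 z2 z3 xy yx _ _ _ _ _ IHa] /=.
  rewrite inE negb_or cat_uniq -andbA => /and5P[neq _ _ ua /andP[_ ub]] d.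
  rewrite !inE mem_cat => /or4P[/eqP->|/eqP->|da|db].
  - by rewrite xy eq_sym.
  - by rewrite yx.
  - exact: IHa.
  exact: IHb.
rewrite inE negb_or -andbA => /and4P[neq _ _ ul] d.
rewrite !inE => /or3P[/eqP->|/eqP->|]; last exact: IHa.
  by rewrite xy eq_sym.
by rewrite yx.
Qed.

Lemma glued_map (D' : eqType) (s : D -> D') al ph (al' ph' : D' -> D') t l w :
  (forall x, al' (s x) = s (al x)) -> (forall x, ph' (s x) = s (ph x)) ->
  glued al ph t l w -> glued al' ph' t (map s l) (map s w).
Proof.
move=> sal sph; elim=> {t l w} [|a b la lb wa wb x y xy yx _ ga _ gb
    |a l w x y z1 z2 z3 xy yx yz1 z12 z23 z3y _ ga] /=.
- exact: GluedVertex.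
- by rewrite !map_cat /=; apply: GluedBridge; rewrite ?sal ?xy ?yx.
apply: (@GluedQuad _ _ _ _ _ _ _ _ (s z1) (s z2) (s z3));
  by rewrite ?sal ?sph ?xy ?yx ?yz1 ?z12 ?z23 ?z3y.
Qed.

End Glued.

(** * Every planar disc has a gluing *)

Section PlanarGlued.
Variable D : finType.
Implicit Types (al sg ph : {perm D}) (c l w : seq D) (x y d : D).

(** An explicit trajectory rather than an orbit size, because the sides of the quadrangle have to be
    spliced into the boundary word. *)
Definition quad_at ph d :=
  uniq (traject ph d 4) && fcycle ph (traject ph d 4).

Lemma quad_at_tperm ph x y d :
  x \notin porbit ph d -> y \notin porbit ph d ->
  quad_at (tperm x y * ph)%g d = quad_at ph d.
Proof.
move=> xd yd; suff E i : (tperm x y * ph)%g ((ph ^+ i)%g d) = (ph ^+ i.+1)%g d.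
  have E0 := E 0; have E1 := E 1; have E2 := E 2; have E3 := E 3.
  move: E0 E1 E2 E3; rewrite !(expgSr, expg0, mul1g, perm1, permM) => E0 E1 E2 E3.
  by rewrite /quad_at /= !permM E0 E1 E2 E3.
rewrite expgSr !permM tpermD //.
  by apply: contraNneq xd => ->; rewrite mem_porbit.
by apply: contraNneq yd => ->; rewrite mem_porbit.
Qed.

Lemma filter_alive_rm al x y c : involutive al -> al x = y -> x != y ->
  x \notin c -> y \notin c ->
  [seq z <- c | z \in alive (tperm x y * al)%g] = [seq z <- c | z \in alive al].
Proof.
move=> alK xy neq xc yc; apply: eq_in_filter => z zc.
rewrite (alive_rm_edge alK xy neq) !in_setD1.
by case: eqP zc yc => [-> ->|_ zc _] //; case: eqP zc xc => [-> ->|].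
Qed.

Lemma porbit_fcycleN ph c x d :
  fcycle ph c -> x \in c -> d \notin c -> x \notin porbit ph d.
Proof. by move=> cc xc; rewrite porbit_sym (porbit_fcycle cc xc). Qed.

(** Deleted darts stay on the face cycle [c], so the boundary word is [c] with them filtered out.
    The last clause confines [l] to surviving edges in the components of [c]: it yields the
    disjointness of the two lists at a bridge, and lets a gluing be read in the permutations before
    the deletion. *)
Definition has_gluing al sg c := exists t l,
  [/\ glued al (al * sg)%g t l [seq z <- c | z \in alive al], uniq l &
      {in l, forall d, d \in alive al /\ exists2 u, u \in c & linked al sg u d}].

Section Step.
Variables (k : nat) (al sg : {perm D}) (x y : D) (c : seq D).
Hypotheses (alK : involutive al) (xy : al x = y) (neq : x != y).
Let ph := (al * sg)%g.
Let al' := (tperm x y * al)%g.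
Let ph' := (al' * sg)%g.
Hypotheses (uc : uniq (x :: c)) (cc : fcycle ph (x :: c)).
Hypothesis quads : forall u d, u \in x :: c -> linked al sg u d ->
  d \notin x :: c -> (d \in alive al) /\ quad_at ph d.

Let ph'E : ph' = (tperm x y * ph)%g. Proof. by rewrite /ph' mulgA. Qed.

Let quad_rm d : linked al sg x d -> d \notin x :: c -> y \notin porbit ph d ->
  (d \in alive al') /\ quad_at ph' d.
Proof.
move=> xd dc yd; have [da qd] := quads (mem_head x c) xd dc.
have xd' := porbit_fcycleN cc (mem_head x c) dc.
split; last by rewrite ph'E quad_at_tperm.
rewrite alive_rm_edge // !in_setD1 da andbT.
by apply/andP; split; [apply: contraNneq yd => <- | apply: contraNneq xd' => <-];
   rewrite porbit_id.
Qed.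

Let eq_rm d : d \in alive al' -> al' d = al d /\ ph' d = ph d.
Proof.
rewrite alive_rm_edge // !in_setD1 => /and3P[dy dx _].
rewrite ph'E [(_ * ph)%g d]permM tpermD 1?eq_sym //; split=> //.
by rewrite (rm_edgeE alK xy neq) (negPf dx) (negPf dy).
Qed.

Let glued_rm t l w : {in l, forall d, d \in alive al'} ->
  glued al' ph' t l w -> glued al ph t l w.
Proof.
by move=> la; apply: glued_eq => d /la/eq_rm[].
Qed.

Hypothesis IH : forall c', #|porbits sg| + #|porbits ph'| =
    k + #|components al' sg|.*2 ->
  uniq c' -> fcycle ph' c' ->
  (forall u d, u \in c' -> linked al' sg u d -> d \notin c' ->
     (d \in alive al') /\ quad_at ph' d) -> has_gluing al' sg c'.
Hypothesis alk : #|alive al'| = k.*2.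
Hypothesis planar :
  #|porbits sg| + #|porbits ph| = k.+1 + #|components al sg|.*2.

Let link_c d : d \in x :: c -> linked al sg x d.
Proof. exact: linked_fcycle cc (mem_head _ _). Qed.

Lemma gluing_split : y \in c -> has_gluing al sg (x :: c).
Proof.
move=> yc; have yp : y \in porbit ph x.
  by rewrite (porbit_fcycle cc (mem_head _ _)) inE yc orbT.
have cs := card_porbits_split neq yp; rewrite -ph'E in cs.
have := euler_le sg (rm_edgeK alK xy neq) alk; rewrite -/al' -/ph' cs => le.
have leK := card_components_rm sg alK xy neq; rewrite -/al' in leK.
(* One face more and one edge less: Euler's inequality demands at least one new component, and a
   deletion creates at most one. *)
have eqK : #|components al' sg| = #|components al sg|.+1 by lia.
have planar' : #|porbits sg| + #|porbits ph'| = k + #|components al' sg|.*2.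
  by rewrite eqK cs; lia.
have nxy : ~~ linked al' sg x y.
  apply/negP=> /(card_components_rm_eq alK xy neq); rewrite -/al' eqK; lia.
case/splitPr: yc uc cc quad_rm link_c => A B ucAB ccAB quadAB link_AB.
have [cA cB] := fcycle_split ucAB ccAB; rewrite -ph'E in cA cB.
move: (ucAB); rewrite cons_uniq mem_cat inE cat_uniq /= !negb_or.
case/and5P=> [/and3P[xA _ xB] uA /andP[yA AB] yB uB].
have linkA u : u \in y :: A -> linked al' sg y u.
  by apply: linked_fcycle cA (mem_head _ _).
have linkB u : u \in x :: B -> linked al' sg x u.
  by apply: linked_fcycle cB (mem_head _ _).
(* No dart is linked to both halves; this keeps the induction hypotheses for the halves independent,
   and their dart lists disjoint. *)
have notAB z : z \in [:: y & A] -> forall d, linked al' sg z d ->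
    linked al' sg x d -> False.
  move=> zA d zd xd; case/negP: nxy; apply: linked_trans xd _.
  by rewrite linked_sym; apply: linked_trans zd; apply: linkA.
have sub z : (z \in [:: x & A ++ y :: B]) = (z \in y :: A) || (z \in x :: B).
  by rewrite !(inE, mem_cat); case: (z == x) (z == y) => [] [];
     rewrite /= ?orbT.
have linkc z d : z \in [:: x & A ++ y :: B] -> linked al' sg z d ->
    linked al sg x d.
  by move=> /link_AB xz /(linked_rm alK xy neq); apply: linked_trans.
(* The dart [y] is now dead but still lies on this face cycle; filtering removes it from the
   word. *)
have [||||a [la [ga ula lla]]] := IH (c' := y :: A).
- exact: planar'.
- by rewrite /= yA.
- by [].
- move=> u d uA' ud dA; have uc' : u \in [:: x & A ++ y :: B].
    by rewrite sub uA'.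
  have dc : d \notin [:: x & A ++ y :: B].
    by rewrite sub negb_or dA; apply/negP => /linkB; apply: notAB uA' _ ud.
  apply: quadAB => //; first exact: linkc uc' ud.
  by apply: porbit_fcycleN ccAB _ dc; rewrite sub mem_head.
have [||||b [lb [gb ulb llb]]] := IH (c' := x :: B).
- exact: planar'.
- by rewrite /= xB.
- by [].
- move=> u d uB' ud dB; have uc' : u \in [:: x & A ++ y :: B].
    by rewrite sub uB' orbT.
  have dc : d \notin [:: x & A ++ y :: B].
    rewrite sub negb_or dB andbT; apply/negP => /notAB; apply; first exact: linked_refl.
    by apply: linked_trans ud; apply: linkB.
  apply: quadAB => //; first exact: linkc uc' ud.
  by apply: porbit_fcycleN ccAB _ dc; rewrite sub mem_head.
have xa : x \in alive al by rewrite inE xy eq_sym.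
have ya : y \in alive al by rewrite inE -xy alK xy.
exists (Bridge a b), [:: x, y & la ++ lb]; split.
- move: ga gb; rewrite -/ph' /= xa filter_cat /= ya.
  rewrite alive_rm_edge // !in_setD1 !eqxx !andbF -alive_rm_edge //=.
  rewrite !(filter_alive_rm alK xy neq) // => ga gb.
  apply: GluedBridge => //; first by rewrite -xy alK.
    by apply: glued_rm ga => d /lla[].
  by apply: glued_rm gb => d /llb[].
- have notl l : (forall d, d \in l -> d \in alive al') -> x \notin l /\ y \notin l.
    move=> la'; split; apply/negP => /la'; rewrite alive_rm_edge // !in_setD1;
    by rewrite eqxx ?andbF.
  have [xla yla] := notl la (fun d dl => (lla d dl).1).
  have [xlb ylb] := notl lb (fun d dl => (llb d dl).1).
  rewrite /= inE !mem_cat !negb_or neq xla yla xlb ylb cat_uniq ula ulb /= andbT.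
  apply/hasPn => d /llb[_ [v vB vd]]; apply/negP => /lla[_ [u uA' ud]].
  by apply: (notAB _ uA' _ ud); apply: linked_trans vd; apply: linkB.
move=> d dl; have: [|| d == x, d == y, d \in la | d \in lb].
  by move: dl; rewrite !inE mem_cat.
case/or4P=> [/eqP->|/eqP->|{}dl|{}dl].
- by split=> //; exists x; rewrite ?mem_head ?linked_refl.
- split=> //; exists y; rewrite ?linked_refl //.
  by rewrite sub mem_head.
- have [da [u uA' ud]] := lla d dl; split.
    by move: da; rewrite alive_rm_edge // !in_setD1 => /and3P[].
  by exists u; rewrite ?sub ?uA' //; apply: linked_rm ud.
have [da [u uB' ud]] := llb d dl; split.
  by move: da; rewrite alive_rm_edge // !in_setD1 => /and3P[].
by exists u; rewrite ?sub ?uB' ?orbT //; apply: linked_rm ud.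
Qed.
(** The face of [y] is one of the quadrangles, disjoint from the root cycle, and the two cycles
    become one. As [x] and [y] share it, they remain linked: E and F both drop by one while V and K
    stay, so the Euler equality is preserved. *)
Lemma gluing_merge : y \notin c -> has_gluing al sg (x :: c).
Proof.
move=> yc; have yc' : y \notin x :: c by rewrite inE negb_or eq_sym neq.
have yp : y \notin porbit ph x by rewrite (porbit_fcycle cc (mem_head _ _)).
have cs := card_porbits_merge neq yp; rewrite -ph'E in cs.
have lxy : linked al sg x y by rewrite -xy linked_rev.
have [ya] := quads (mem_head _ _) lxy yc'.
rewrite /quad_at; set z1 := ph y; set z2 := ph z1; set z3 := ph z2 => /andP[].
have -> : traject ph y 4 = [:: y; z1; z2; z3] by [].
move=> uq cq; have qc z : z \in [:: y; z1; z2; z3] -> z \notin x :: c.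
  move=> zq; apply: contra yp => zc; rewrite -eq_porbit_mem.
  have: x \in porbit ph z by rewrite (porbit_fcycle cc zc) mem_head.
  have: y \in porbit ph z by rewrite (porbit_fcycle cq zq) mem_head.
  by rewrite -!eq_porbit_mem => /eqP-> /eqP->.
have uq' : uniq (x :: c ++ [:: y; z1; z2; z3]).
  rewrite -cat_cons cat_uniq uc uq andbT.
  by apply/hasPn => z zq; apply: qc.
have cm := fcycle_merge uq' cc cq; rewrite -ph'E in cm.
set c' := x :: _ in cm.
have pc' : perm_eq c' (x :: c ++ [:: y; z1; z2; z3]).
  rewrite perm_cons; apply/seq.permP => p; rewrite !count_cat [count p (y :: c)]/=.
  by rewrite [count p [:: y; _; _; _]]/= addnCA [RHS]addnCA [X in _ = _ + X]addnC.
have mem_c' z : (z \in c') = (z \in x :: c) || (z \in [:: y; z1; z2; z3]).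
  by rewrite (perm_mem pc') -cat_cons mem_cat.
have uc' : uniq c' by rewrite (perm_uniq pc').
have lk' u d : u \in c' -> linked al' sg u d -> linked al' sg x d.
  by move=> uc2; apply: linked_trans; apply: linked_fcycle cm (mem_head _ _) uc2.
have lxy' : linked al' sg x y.
  by apply: linked_fcycle cm (mem_head _ _) _; rewrite mem_c' mem_head orbT.
have eqK := card_components_rm_eq alK xy neq lxy'; rewrite -/al' in eqK.
have planar' : #|porbits sg| + #|porbits ph'| = k + #|components al' sg|.*2.
  by apply: succn_inj; rewrite -addnS cs eqK planar addSn.
have [||||t [l [gt ul ll]]] := IH (c' := c').
- exact: planar'.
- exact: uc'.
- exact: cm.
- move=> u d uc2 ud; rewrite mem_c' negb_or => /andP[dc dq].
  apply: quad_rm => //; first exact: linked_rm (lk' _ _ uc2 ud).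
  exact: porbit_fcycleN cq (mem_head _ _) dq.
exists (Quad t), [:: x, y & l]; split.
- have za z : z \in [:: z1; z2; z3] -> z \in alive al'.
    move=> zz; have zq : z \in [:: y; z1; z2; z3] by rewrite inE zz orbT.
    have xz : linked al sg x z.
      by apply: linked_rm (lk' z _ _ (linked_refl _ _ _)); rewrite // mem_c' zq orbT.
    have [zal _] := quads (mem_head _ _) xz (qc _ zq).
    rewrite alive_rm_edge // !in_setD1 zal andbT; apply/andP; split.
      by apply: contraTneq zz => ->; case/andP: uq.
    by apply: contraNneq (qc _ zq) => ->; apply: mem_head.
  have xa : x \in alive al by rewrite inE xy eq_sym.
  have [za1 za2 za3] : [/\ z1 \in alive al', z2 \in alive al' & z3 \in alive al'].
    by split; apply: za; rewrite !inE eqxx ?orbT.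
  have xa' : (x \in alive al') = false.
    by rewrite alive_rm_edge // !in_setD1 eqxx andbF.
  have ya' : (y \in alive al') = false by rewrite alive_rm_edge // setD11.
  move: gt; rewrite -/ph' /c' /= xa xa' za1 za2 za3 ya'.
  rewrite (filter_alive_rm alK xy neq) //; last by case/andP: uc.
  move=> gt.
  apply: (GluedQuad (y := y) (z1 := z1) (z2 := z2) (z3 := z3)) => //.
  + by rewrite -xy alK.
  + by have /= /and5P[_ _ _ /eqP] := cq.
  by apply: glued_rm gt => d /ll[].
- have notl z : z \in [:: x; y] -> z \notin l.
    move=> zz; apply/negP => /ll[+ _]; rewrite alive_rm_edge // !in_setD1.
    by move: zz; rewrite !inE => /orP[]/eqP->; rewrite eqxx ?andbF.
  by rewrite /= inE negb_or neq !notl ?inE ?eqxx ?orbT.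
have xy_c d : d \in [:: x, y & l] -> d \in alive al /\ linked al sg x d.
  move=> dl; have: [|| d == x, d == y | d \in l] by move: dl; rewrite !inE.
  case/or3P=> [/eqP->|/eqP->|/ll[da [u uc2 ud]]].
  - by rewrite inE xy eq_sym linked_refl.
  - by [].
  split; last exact: linked_rm (lk' _ _ uc2 ud).
  by move: da; rewrite alive_rm_edge // !in_setD1 => /and3P[].
by move=> d /xy_c[da xd]; split=> //; exists x; rewrite ?mem_head.
Qed.

End Step.
(** Induction on the number of surviving edges. Other components may be present, and dead darts are
    allowed on [c] itself, but not elsewhere in its components; both situations arise after a
    deletion. *)
Lemma planar_has_gluing k al sg c : involutive al -> #|alive al| = k.*2 ->
  #|porbits sg| + #|porbits (al * sg)%g| = k + #|components al sg|.*2 ->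
  uniq c -> fcycle (al * sg)%g c ->
  (forall u d, u \in c -> linked al sg u d -> d \notin c ->
     (d \in alive al) /\ quad_at (al * sg)%g d) ->
  has_gluing al sg c.
Proof.
have dead al' c' : [seq z <- c' | z \in alive al'] = [::] ->
    has_gluing al' sg c'.
  by move=> Ec; exists Vertex, [::]; rewrite Ec; split=> //; apply: GluedVertex.
elim: k al c => [|k IHk] al c alK alk planar uc cc quads;
  case Ec: [seq z <- c | z \in alive al] => [|x w]; try exact: dead.
  have [a [b [_ xa _ _]]] := filter_cons_cat Ec.
  by rewrite (alive0 alk) inE perm1 eqxx in xa.
have [a [b [def_c xa fa fb]]] := filter_cons_cat Ec.
(* The cycle may start with dead darts. Rotating it to its first living dart leaves the filtered
   word unchanged. *)
have defr : rot (size a) c = x :: b ++ a by rewrite def_c rot_size_cat.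
have memr : c =i x :: b ++ a by move=> z; rewrite -defr mem_rot.
suff [t [l [gt ul ll]]] : has_gluing al sg (x :: b ++ a).
  exists t, l; split=> //.
    by move: gt; rewrite Ec /= xa filter_cat fa fb cats0.
  by move=> d /ll[da [u uc' ud]]; split=> //; exists u; rewrite // memr.
have [y xy] : {y | al x = y} by exists (al x).
have neq : x != y by move: xa; rewrite inE xy eq_sym.
have uc' : uniq (x :: b ++ a) by rewrite -defr rot_uniq.
have cc' : fcycle (al * sg)%g (x :: b ++ a) by rewrite -defr rot_cycle.
have quads' u d : u \in x :: b ++ a -> linked al sg u d ->
    d \notin x :: b ++ a -> (d \in alive al) /\ quad_at (al * sg)%g d.
  by rewrite -!memr; apply: quads.
have alk' := card_alive_rm alK xy neq alk.
have IH c' := IHk _ c' (rm_edgeK alK xy neq) alk'.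
have [yc|yc] := boolP (y \in b ++ a).
  exact: (gluing_split alK xy neq uc' cc' quads' IH alk' planar yc).
exact: (gluing_merge alK xy neq uc' cc' quads' IH planar yc).
Qed.

End PlanarGlued.

(** * Maps realizing a tree *)

Section VertexCount.
Variable D : finType.
Implicit Types (al ph : {perm D}) (c l w : seq D).

Lemma fcycle_eq_in (f g : D -> D) c : {in c, f =1 g} -> fcycle f c -> fcycle g c.
Proof.
move=> fg; rewrite (eq_in_cycle (P := mem c) (e' := frel g)) //.
  by move=> u v /fg /= -> _.
Qed.

(* Removing one by one the edges met by the gluing leaves the vertex
   permutation [al * ph] unchanged. *)
Lemma glued_unglue t l w al ph c : glued al ph t l w -> involutive al ->
  uniq l -> uniq c -> fcycle ph c -> [seq z <- c | z \in alive al] = w ->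
  exists al' ph' : {perm D},
  [/\ involutive al', forall d, al' d = if d \in l then d else al d,
      forall d, d \notin l -> d \notin c -> ph' d = ph d,
      (al' * ph' = al * ph)%g &
      #|porbits ph'| + nb_quads t = #|porbits ph| + nb_bridges t].
Proof.
elim: t l w al ph c => [|a IHa b IHb|a IHa] l w al ph c gl alK ul uc cc fc;
  have := glued_inv gl.
- by case=> -> _; exists al, ph.
- case=> x [y [la [lb [wa [wb [El Ew [xy _] ga gb]]]]]].
  have lal := glued_moves gl ul.
  move: ul fc; rewrite El Ew => ul /filter_cons_cat[p [q [Ec xal fp fq]]].
  move: (ul); rewrite /= inE !mem_cat !negb_or cat_uniq.
  case/and5P=> /and3P[neq xla xlb] /andP[yla ylb] ula /hasPn disj ulb.
  have defr : rot (size p) c = x :: q ++ p by rewrite Ec rot_size_cat.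
  have memr : c =i x :: q ++ p by move=> z; rewrite -defr mem_rot.
  have uc1 : uniq (x :: q ++ p) by rewrite -defr rot_uniq.
  have cc1 : fcycle ph (x :: q ++ p) by rewrite -defr rot_cycle.
  have fc1 : [seq z <- q ++ p | z \in alive al] = wa ++ y :: wb.
    by rewrite filter_cat fp fq cats0.
  have [A [B [Eqp fA fB]]] : exists A B, [/\ q ++ p = A ++ y :: B,
      [seq z <- A | z \in alive al] = wa & [seq z <- B | z \in alive al] = wb].
    have : y \in q ++ p.
      have : y \in wa ++ y :: wb by rewrite mem_cat mem_head orbT.
      by rewrite -fc1 mem_filter => /andP[].
    have yal : y \in alive al by rewrite inE lal // El !inE eqxx orbT.
    move=> yqp; case/splitPr: yqp fc1 uc1 => A B; rewrite filter_cat /= yal.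
    move=> E; rewrite mem_cat cat_uniq /= => /and4P[_ _ /norP[yA _] _].
    have yA' : y \notin [seq z <- A | z \in alive al].
      by rewrite mem_filter negb_and yA orbT.
    have [<- <-] := cat_cons_inj yA' (contra (glued_sub ga (x := y)) yla) E.
    by exists A, B.
  rewrite Eqp in uc1 cc1 memr.
  have yp : y \in porbit ph x.
    by rewrite (porbit_fcycle cc1 (mem_head _ _)) !(inE, mem_cat) eqxx !orbT.
  have cs := card_porbits_split neq yp.
  have [cA cB] := fcycle_split uc1 cc1.
  have E1 := rm_edgeE alK xy neq.
  pose al1 := (tperm x y * al)%g; pose ph1 := (tperm x y * ph)%g.
  have al1E d : d != x -> d != y -> al1 d = al d.
    by rewrite E1 => /negPf-> /negPf->.
  have ph1E d : d != x -> d != y -> ph1 d = ph d.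
    by move=> dx dy; rewrite permM tpermD // eq_sym.
  have ne d (m : seq D) : d \in m -> x \notin m -> y \notin m -> d != x /\ d != y.
    by move=> dm xm ym; split; apply: contraTneq dm => ->.
  move: (uc1); rewrite cons_uniq mem_cat inE cat_uniq /= !negb_or.
  case/and5P=> /and3P[xA _ xB] uA /andP[yA /hasPn AB] yB uB.
  have [al2 [ph2 [al2K al2E ph2E v2 n2]]] :
      exists al2 ph2 : {perm D},
      [/\ involutive al2, forall d, al2 d = if d \in la then d else al1 d,
          forall d, d \notin la -> d \notin y :: A -> ph2 d = ph1 d,
          (al2 * ph2 = al1 * ph1)%g &
          #|porbits ph2| + nb_quads a = #|porbits ph1| + nb_bridges a].
    apply: (IHa la wa al1 ph1 (y :: A)) => //.
    - apply: (glued_eq _ _ ga) => d da; have [dx dy] := ne d la da xla yla.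
        by rewrite al1E.
      by rewrite ph1E.
    - exact: rm_edgeK.
    - by rewrite /= yA.
    rewrite /= alive_rm_edge // !in_setD1 eqxx /= -alive_rm_edge //.
    by rewrite filter_alive_rm.
  have lbal d : d \in lb -> d \in alive al.
    by move=> db; rewrite inE lal // El !inE mem_cat db !orbT.
  have BnA d : d \in x :: B -> d \notin y :: A.
    rewrite !inE => /orP[/eqP->|dB]; first by rewrite negb_or neq.
    rewrite negb_or AB // andbT; by apply: contraTneq dB => ->.
  have Bnla d : d \in x :: B -> d \notin la.
    rewrite inE => /orP[/eqP-> //|dB]; apply/negP => da.
    have db : d \in lb.
      apply: (glued_sub gb); rewrite -fB mem_filter dB andbT inE lal //.
      by rewrite El !inE mem_cat da !orbT.
    by move: (disj d db); rewrite /= da.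
  (* The second half is removed from what the first one left. The gluing of [b] is still valid
     there, since [al2] and [ph2] differ from [al1] and [ph1] only on darts of [la] and of the cycle
     [y :: A]. *)
  have [al3 [ph3 [al3K al3E ph3E v3 n3]]] :
      exists al3 ph3 : {perm D},
      [/\ involutive al3, forall d, al3 d = if d \in lb then d else al2 d,
          forall d, d \notin lb -> d \notin x :: B -> ph3 d = ph2 d,
          (al3 * ph3 = al2 * ph2)%g &
          #|porbits ph3| + nb_quads b = #|porbits ph2| + nb_bridges b].
    apply: (IHb lb wb al2 ph2 (x :: B)) => //.
    - apply: (glued_eq _ _ gb) => d db; have [dx dy] := ne d lb db xlb ylb.
        by rewrite al2E (negPf (disj d db)) al1E.
      rewrite ph2E ?ph1E //; first exact: disj.
      apply/negP; rewrite inE (negPf dy) /= => dA.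
      have : d \in wa by rewrite -fA mem_filter lbal.
      by move/(glued_sub ga); apply/negP/disj.
    - by rewrite /= xB.
    - apply: fcycle_eq_in cB => d dB; rewrite ph2E //; last exact: BnA.
      exact: Bnla.
    rewrite /= inE al2E (negPf xla) E1 eqxx /= eqxx /= -fB.
    apply: eq_in_filter => d dB; have [dx dy] := ne d B dB xB yB.
    by rewrite !inE al2E (negPf (Bnla d _)) ?inE ?dB ?orbT // al1E.
  exists al3, ph3; split=> //.
  - move=> d; rewrite al3E al2E E1 !inE mem_cat.
    by case: (d == x); case: (d == y); case: (d \in la); case: (d \in lb).
  - move=> d; rewrite !inE mem_cat !negb_or memr => /and4P[dx dy dla dlb] dc.
    have dAB : d \notin y :: A /\ d \notin x :: B.
      move: dc; rewrite !(inE, mem_cat) !negb_or.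
      by case/and4P=> -> -> -> ->.
    by rewrite ph3E ?ph2E ?ph1E //; case: dAB.
  - by rewrite v3 v2 rm_edge_vertex.
  by rewrite /= [nb_quads a + _]addnC addnA n3 addnAC n2 cs addnS addnA !addSn.
case=> x [y [l' [w' [z1 [z2 [z3 [El Ew [xy _] [ga [yz1 z12 z23 z3y]]]]]]]]].
have lal := glued_moves gl ul.
move: ul fc; rewrite El Ew => ul /filter_cons_cat[p [q [Ec xal fp fq]]].
move: (ul); rewrite /= inE negb_or -andbA => /and4P[neq xl yl ul'].
have defr : rot (size p) c = x :: q ++ p by rewrite Ec rot_size_cat.
have memr : c =i x :: q ++ p by move=> z; rewrite -defr mem_rot.
have uc1 : uniq (x :: q ++ p) by rewrite -defr rot_uniq.
have cc1 : fcycle ph (x :: q ++ p) by rewrite -defr rot_cycle.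
have fc1 : [seq z <- q ++ p | z \in alive al] = w'.
  by rewrite filter_cat fp fq cats0.
move: (q ++ p) memr uc1 cc1 fc1 {defr} => c1 memr uc1 cc1 fc1.
have yal : y \in alive al by rewrite inE lal // El !inE eqxx orbT.
have yc : y \notin x :: c1.
  rewrite inE negb_or eq_sym neq; apply: contra yl => yc.
  by apply: (glued_sub ga); rewrite !inE -fc1 mem_filter yal yc !orbT.
have yp : y \notin porbit ph x by rewrite (porbit_fcycle cc1 (mem_head _ _)).
have cs := card_porbits_merge neq yp.
have z_l z : z \in [:: z1; z2; z3] -> z \in l'.
  move=> zz; apply: (glued_sub ga); move: zz; rewrite !inE.
  by case/or3P=> ->; rewrite ?orbT.
have uq : uniq [:: y; z1; z2; z3].
  have /= := glued_uniq ga ul'; rewrite !inE !negb_or.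
  case/and4P=> /and3P[-> -> _] /andP[-> _] _ _; rewrite !andbT.
  apply/and3P; split; apply: contraNneq yl => ->; apply: z_l;
  by rewrite !inE eqxx ?orbT.
have cq : fcycle ph [:: y; z1; z2; z3] by rewrite /= yz1 z12 z23 z3y !eqxx.
have qc z : z \in [:: y; z1; z2; z3] -> z \notin x :: c1.
  move=> zq; apply: contra yp => zc; rewrite -eq_porbit_mem.
  have: x \in porbit ph z by rewrite (porbit_fcycle cc1 zc) mem_head.
  have: y \in porbit ph z by rewrite (porbit_fcycle cq zq) mem_head.
  by rewrite -!eq_porbit_mem => /eqP-> /eqP->.
have uq' : uniq (x :: c1 ++ [:: y; z1; z2; z3]).
  rewrite -cat_cons cat_uniq uc1 uq andbT.
  by apply/hasPn => z zq; apply: qc.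
have cm := fcycle_merge uq' cc1 cq.
have E1 := rm_edgeE alK xy neq.
pose al1 := (tperm x y * al)%g; pose ph1 := (tperm x y * ph)%g.
have al1E d : d != x -> d != y -> al1 d = al d.
  by rewrite E1 => /negPf-> /negPf->.
have ph1E d : d != x -> d != y -> ph1 d = ph d.
  by move=> dx dy; rewrite permM tpermD // eq_sym.
have ne d (m : seq D) : d \in m -> x \notin m -> y \notin m -> d != x /\ d != y.
  by move=> dm xm ym; split; apply: contraTneq dm => ->.
have l'al d : d \in l' -> d \in alive al1.
  move=> dl; have [dx dy] := ne d l' dl xl yl.
  by rewrite inE al1E // lal // El !inE dl !orbT.
set c' := x :: _ in cm.
have pc' : perm_eq c' (x :: c1 ++ [:: y; z1; z2; z3]).
  rewrite perm_cons; apply/seq.permP => u; rewrite !count_cat [count u (y :: c1)]/=.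
  by rewrite [count u [:: y; _; _; _]]/= addnCA [RHS]addnCA [X in _ = _ + X]addnC.
have [al2 [ph2 [al2K al2E ph2E v2 n2]]] :
    exists al2 ph2 : {perm D},
    [/\ involutive al2, forall d, al2 d = if d \in l' then d else al1 d,
        forall d, d \notin l' -> d \notin c' -> ph2 d = ph1 d,
        (al2 * ph2 = al1 * ph1)%g &
        #|porbits ph2| + nb_quads a = #|porbits ph1| + nb_bridges a].
  apply: (IHa l' [:: z1, z2, z3 & w'] al1 ph1 c') => //.
  - apply: (glued_eq _ _ ga) => d da; have [dx dy] := ne d l' da xl yl.
      by rewrite al1E.
    by rewrite ph1E.
  - exact: rm_edgeK.
  - by rewrite (perm_uniq pc').
  have [za1 za2 za3] : [/\ z1 \in alive al1, z2 \in alive al1 & z3 \in alive al1].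
    by split; apply/l'al/z_l; rewrite !inE eqxx ?orbT.
  have xa' : (x \in alive al1) = false.
    by rewrite alive_rm_edge // !in_setD1 eqxx andbF.
  have ya' : (y \in alive al1) = false by rewrite alive_rm_edge // setD11.
  rewrite /c' /= xa' za1 za2 za3 ya' filter_alive_rm ?fc1 //.
    by case/andP: uc1.
  by move: yc; rewrite inE negb_or => /andP[].
exists al2, ph2; split=> //.
- move=> d; rewrite al2E E1 !inE.
  by case: (d == x); case: (d == y); case: (d \in l').
- move=> d; rewrite !inE !negb_or memr => /and3P[dx dy dl] dc.
  have dz : d \notin [:: z1; z2; z3] by apply: contra dl; apply: z_l.
  rewrite ph2E ?ph1E // (perm_mem pc') -cat_cons mem_cat negb_or dc in_cons.
  by rewrite negb_or dy.
- by rewrite v2 rm_edge_vertex.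
by rewrite /= addnS n2 -addSn cs.
Qed.

End VertexCount.

(** * Permutations with prescribed edges and faces *)

Lemma perm_of_cycles (D : finType) (cs : seq (seq D)) : uniq (flatten cs) ->
  exists s : {perm D}, forall c, c \in cs -> fcycle s c.
Proof.
suff H : uniq (flatten cs) -> exists s : {perm D},
    (forall c, c \in cs -> fcycle s c) /\ forall x, x \notin flatten cs -> s x = x.
  by case/H=> s [cyc _]; exists s.
elim: cs => [|c cs IHcs] /=; first by exists 1%g; split=> // x _; rewrite perm1.
rewrite cat_uniq => /and3P[uc /hasPn disj /IHcs[s [cyc fix_s]]].
have ci : injective (next c) := can_inj (prev_next uc).
have E x : (perm ci * s)%g x = if x \in c then next c x else s x.
  rewrite permM permE; case: ifP => xc; last by rewrite next_nth xc.
  by rewrite fix_s //; apply: contraL xc => /disj; rewrite /= mem_next.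
exists (perm ci * s)%g; split=> [c' | x].
  rewrite inE => /orP[/eqP-> | c'cs].
    by apply: (@fcycle_eq_in _ (next c)) (cycle_next uc) => x xc; rewrite E xc.
  apply: (@fcycle_eq_in _ s) (cyc _ c'cs) => x xc'.
  by rewrite E ifN //; apply: disj; apply/flattenP; exists c'.
by rewrite mem_cat negb_or E => /andP[/negPf-> /fix_s].
Qed.

Lemma card_porbits_cycles (D : finType) (s : {perm D}) (cs : seq (seq D)) :
  (forall c, c \in cs -> fcycle s c /\ c != [::]) -> uniq (flatten cs) ->
  flatten cs =i D -> #|porbits s| = size cs.
Proof.
move=> cyc ucs all_cs; pose f (c : seq D) := [set x in c].
have -> : #|porbits s| = #|map f cs|.
  apply: eq_card => A; apply/imsetP/mapP => [[x _ ->] | [c ccs ->]].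
    have /flattenP[c ccs xc] : x \in flatten cs by rewrite all_cs.
    exists c => //; apply/setP => y; rewrite inE.
    by rewrite (porbit_fcycle (cyc _ ccs).1 xc).
  have [] := cyc _ ccs; case: c ccs => // x c ccs cc _; exists x => //.
  by apply/setP => y; rewrite inE (porbit_fcycle cc (mem_head _ _)).
rewrite -[RHS](size_map f); apply/card_uniqP.
elim: cs cyc ucs {all_cs} => //= c cs IHcs cyc.
rewrite cat_uniq => /and3P[_ /hasPn disj ucs].
rewrite IHcs //; last by move=> c' c'cs; apply: cyc; rewrite inE c'cs orbT.
rewrite andbT; apply/mapP => -[c' c'cs /setP eqc].
have [_] := cyc _ (mem_head _ _); case: c eqc disj {cyc} => // x c eqc disj _.
have xc' : x \in c' by have := eqc x; rewrite !inE eqxx.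
have /disj /= : x \in flatten cs by apply/flattenP; exists c'.
by rewrite mem_head.
Qed.

(** Reading [l] as a deletion order, the tree dictates the edges [P], the inner faces [Q] and the
    root face [w]. Lists of polygons pass through the recursion on disjoint parts of [l];
    permutations having them as cycles are built only once, at the end. *)
Lemma tree_polygons (D : eqType) t (l : seq D) : valid t -> uniq l ->
  size l = (nb_bridges t + nb_quads t).*2 ->
  exists w P Q,
  [/\ [/\ perm_eq (flatten P) l, perm_eq (w ++ flatten Q) l
        & size w = (half_perimeter t).*2],
      forall c, c \in P -> size c = 2, forall c, c \in Q -> size c = 4,
      size Q = nb_quads t &
      forall al ph : D -> D, (forall c, c \in P -> fcycle al c) ->
        (forall c, c \in Q -> fcycle ph c) -> glued al ph t l w].
Proof.
elim: t l => [|a IHa b IHb|a IHa] /=.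
- by case=> // _ _ _; exists [::], [::], [::]; split=> // *; apply: GluedVertex.
- move=> [|x [|y l]]; rewrite ?addSn ?doubleS //.
  move=> /andP[va vb] /and3P[_ _ ul] [sl].
  pose n := (nb_bridges a + nb_quads a).*2.
  have := IHa (take n l) va (take_uniq _ ul).
  have := IHb (drop n l) vb (drop_uniq _ ul).
  rewrite size_takel ?size_drop ?sl; last by rewrite /n; lia.
  case; first by rewrite /n; lia.
  move=> wb [Pb [Qb [[pPb pQb swb] Pb2 Qb4 sQb gb]]].
  case=> // wa [Pa [Qa [[pPa pQa swa] Pa2 Qa4 sQa ga]]].
  exists (x :: wa ++ y :: wb), ([:: x; y] :: Pa ++ Pb), (Qa ++ Qb).
  split; first split.
  - by rewrite /= flatten_cat !perm_cons -[X in perm_eq _ X](cat_take_drop n) perm_cat.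
  - apply/seq.permP => u; have /seq.permP/(_ u) := pQa.
    have /seq.permP/(_ u) := pQb; have := count_cat u (take n l) (drop n l).
    rewrite cat_take_drop flatten_cat /= !count_cat /=; clear; lia.
  - by rewrite /= size_cat /= swa swb; lia.
  - move=> c; rewrite inE mem_cat => /or3P[/eqP->|/Pa2|/Pb2] //.
  - by move=> c; rewrite mem_cat => /orP[/Qa4|/Qb4].
  - by rewrite size_cat sQa sQb.
  move=> al ph Pal Qph; rewrite -{1}[l](cat_take_drop n).
  have /= /and3P[/eqP xy /eqP yx _] := Pal _ (mem_head _ _).
  apply: GluedBridge => //; [apply: ga | apply: gb] => c cc.
  - by apply: Pal; rewrite inE mem_cat cc orbT.
  - by apply: Qph; rewrite mem_cat cc.
  - by apply: Pal; rewrite inE mem_cat cc !orbT.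
  by apply: Qph; rewrite mem_cat cc orbT.
move=> [|x [|y l]]; rewrite ?addnS ?doubleS //.
move=> /andP[ha va] /and3P[_ _ ul] [sl].
have [w [P [Q [[pP pQ sw] P2 Q4 sQ ga]]]] := IHa l va ul sl.
case: w sw pQ ga => [|z1 [|z2 [|z3 w]]] /= sw pQ ga; try by move: sw; lia.
exists (x :: w), ([:: x; y] :: P), ([:: y; z1; z2; z3] :: Q).
split; first split.
- by rewrite /= !perm_cons.
- apply/seq.permP => u; have /seq.permP/(_ u) := pQ.
  by rewrite /= !count_cat /=; clear; lia.
- by move: sw => /=; lia.
- by move=> c; rewrite inE => /orP[/eqP->|/P2].
- by move=> c; rewrite inE => /orP[/eqP->|/Q4].
- by rewrite /= sQ.
move=> al ph Pal Qph.
have /= /and3P[/eqP xy /eqP yx _] := Pal _ (mem_head _ _).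
have /= /and5P[/eqP yz1 /eqP z12 /eqP z23 /eqP z3y _] := Qph _ (mem_head _ _).
apply: (GluedQuad xy yx yz1 z12 z23 z3y).
by apply: ga => c cc; [apply: Pal | apply: Qph]; rewrite inE cc orbT.
Qed.

(** * Rooted maps and their trees *)

Section Bisimulation.
Variables (D D' : eqType).
Implicit Types (l w : seq D).

Lemma mem_zip1 l (l' : seq D') p : p \in zip l l' -> p.1 \in l.
Proof.
elim: l l' => [|x l IHl] [|x' l'] //=; rewrite !inE.
by case/predU1P=> [-> | /IHl->]; rewrite ?eqxx ?orbT.
Qed.

Lemma zip_fun l (l' : seq D') p q : uniq l ->
  p \in zip l l' -> q \in zip l l' -> p.1 = q.1 -> p = q.
Proof.
elim: l l' => [|x l IHl] [|x' l'] //= /andP[xl ul]; rewrite !inE.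
case/predU1P=> [-> | pz] /predU1P[-> // | qz] /= E.
- by rewrite E (mem_zip1 qz) in xl.
- by rewrite -E (mem_zip1 pz) in xl.
exact: IHl pz qz E.
Qed.

(** Darts deleted at the same time correspond. Nothing can be said about [ph] on the boundary word,
    since a gluing does not record how that word closes up into a face. *)
Lemma glued_bisim (al ph : D -> D) (al' ph' : D' -> D') t l w
    (l' w' : seq D') :
  glued al ph t l w -> glued al' ph' t l' w' -> uniq l ->
  [/\ forall p, p \in zip l l' -> (al p.1, al' p.2) \in zip l l',
      forall p, p \in zip l l' -> p.1 \notin w -> (ph p.1, ph' p.2) \in zip l l' &
      {subset zip w w' <= zip l l'}].
Proof.
elim: t l w l' w' => [|a IHa b IHb|a IHa] l w l' w' gl gl' ul;
  have := glued_inv gl'; have := glued_inv gl.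
- by case=> -> -> [-> ->].
- case=> x [y [la [lb [wa [wb [El -> [xy yx] ga gb]]]]]].
  case=> x' [y' [la' [lb' [wa' [wb' [-> -> [xy' yx'] ga' gb']]]]]].
  have [_ sla swa] := glued_size ga; have [_ sla' swa'] := glued_size ga'.
  move: ul; rewrite El => /= /and3P[_ _]; rewrite cat_uniq => /and3P[ula _ ulb].
  have [ala pha subw_a] := IHa _ _ _ _ ga ga' ula.
  have [alb phb subw_b] := IHb _ _ _ _ gb gb' ulb.
  have Ez : zip (la ++ lb) (la' ++ lb') = zip la la' ++ zip lb lb'.
    by rewrite zip_cat // sla sla'.
  split=> [p|p|p].
  - rewrite Ez !inE !mem_cat => /or4P[/eqP->|/eqP->|/ala pa|/alb pb] /=.
    + by rewrite xy xy' eqxx orbT.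
    + by rewrite yx yx' eqxx.
    + by rewrite ?mem_cat pa !orbT.
    by rewrite ?mem_cat pb !orbT.
  - rewrite Ez !inE !mem_cat => /or4P[/eqP->|/eqP->|pa|pb] /=.
    + by rewrite eqxx.
    + by rewrite ?mem_cat inE eqxx !orbT.
    + rewrite !(mem_cat, inE) !negb_or => /and4P[_ nwa _ _].
      by rewrite (pha _ pa nwa) !orbT.
    rewrite !(mem_cat, inE) !negb_or => /and4P[_ _ _ nwb].
    by rewrite (phb _ pb nwb) !orbT.
  rewrite /= Ez zip_cat ?swa ?swa' // !(inE, mem_cat).
  by case/or4P=> [->|/subw_a->|->|/subw_b->]; rewrite ?orbT.
case=> x [y [l1 [w1 [z1 [z2 [z3 [El -> [xy yx] [ga [yz1 z12 z23 z3y]]]]]]]]].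
case=> x' [y' [l1' [w1' [u1 [u2 [u3 [-> -> [xy' yx'] [ga' [yu1 u12 u23 u3y]]]]]]]]].
move: ul; rewrite El => /= /and3P[_ _ ul1].
have [ala pha subw] := IHa _ _ _ _ ga ga' ul1.
have [m1 m2 m3] : [/\ (z1, u1) \in zip l1 l1', (z2, u2) \in zip l1 l1'
                    & (z3, u3) \in zip l1 l1'].
  by split; apply: subw; rewrite /= !inE eqxx ?orbT.
split=> [p|p|p].
- rewrite !inE => /or3P[/eqP->|/eqP->|/ala pa] /=.
  + by rewrite xy xy' eqxx orbT.
  + by rewrite yx yx' eqxx.
  by rewrite pa !orbT.
- rewrite !inE => /or3P[/eqP->|/eqP->|pa] /=.
  + by rewrite eqxx.
  + by rewrite yz1 yu1 m1 !orbT.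
  rewrite negb_or => /andP[_ nw1].
  (* A side of the quadrangle is a boundary dart for the subtree but no longer for the whole tree;
     its successor is then read on the face cycle of the quadrangle. *)
  have [pz|] := boolP (p.1 \in [:: z1, z2, z3 & w1]); last first.
    by move=> /(pha _ pa)->; rewrite !orbT.
  move: pz; rewrite !inE (negPf nw1) orbF => /or3P[] /eqP pz.
  + by rewrite (zip_fun ul1 pa m1 pz) /= z12 u12 m2 !orbT.
  + by rewrite (zip_fun ul1 pa m2 pz) /= z23 u23 m3 !orbT.
  by rewrite (zip_fun ul1 pa m3 pz) /= z3y u3y eqxx orbT.
rewrite /= !inE => /predU1P[->|pw]; first by rewrite eqxx.
by rewrite subw ?orbT //= !inE pw !orbT.
Qed.
End Bisimulation.

Lemma uniq_flatten_mem (T : eqType) (cs : seq (seq T)) c :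
  uniq (flatten cs) -> c \in cs -> uniq c.
Proof.
elim: cs => //= c' cs IHcs; rewrite cat_uniq inE => /and3P[uc' _ ucs].
by case/predU1P=> [-> // | /(IHcs ucs)].
Qed.

(** * The tree as a complete invariant of rooted discs *)

Section Encoding.
Variable D : finType.
Implicit Types (m : rmap D) (t : tutte_tree).

Definition quad_disc p m :=
  [&& planar_map m, #|porbit (map_face m) (map_root m)| == p.*2 &
      [forall d, (d \in porbit (map_face m) (map_root m))
                 || (#|porbit (map_face m) d| == 4)]].

Definition encodes t m := exists l w,
  [/\ glued (map_rev m) (map_face m) t l (map_root m :: w), uniq l,
      forall d, d \in l & fcycle (map_face m) (map_root m :: w)].

Lemma is_map_revK m : is_map m -> involutive (map_rev m).
Proof. by move=> /forallP mm d; have /andP[/eqP] := mm d. Qed.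

Lemma is_map_alive m : is_map m -> alive (map_rev m) = setT.
Proof.
by move=> /forallP mm; apply/setP => d; have /andP[_] := mm d; rewrite !inE.
Qed.

Lemma map_nextE m d : is_map m -> map_next m d = map_face m (map_rev m d).
Proof. by move=> /is_map_revK revK; rewrite permM revK. Qed.

Lemma fcycle_iter (s : {perm D}) x c : fcycle s (x :: c) ->
  iter (size c).+1 s x = x.
Proof.
move/fcycle_rconsE/(congr1 (last x)).
by rewrite last_rcons trajectS /= last_traject -iterSr.
Qed.

(** The isomorphism sends each dart to the one at the same position in the other deletion order. *)
Lemma encodes_iso t m1 m2 : is_map m1 -> is_map m2 ->
  encodes t m1 -> encodes t m2 -> rmap_iso m1 m2.
Proof.
move=> map1 map2 [l1 [w1 [g1 u1 all1 c1]]] [l2 [w2 [g2 u2 all2 c2]]].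
have [_ sl1 sw1] := glued_size g1; have [_ sl2 sw2] := glued_size g2.
have eq_sl : size l1 = size l2 by rewrite sl1.
have eq_sw : size w1 = size w2 by move: sw1; rewrite -sw2 => -[].
have [bal bph subw] := glued_bisim g1 g2 u1.
set Z := zip l1 l2 in bal bph subw.
pose f d := nth (map_root m2) l2 (index d l1).
have Zf d : (d, f d) \in Z.
  have dl : index d l1 < size l1 by rewrite index_mem.
  have := mem_nth (d, map_root m2) (_ : index d l1 < size Z).
  rewrite nth_zip // nth_index // => -> //.
  by rewrite size_zip -eq_sl minnn.
have Zfun p q : p \in Z -> q \in Z -> p.1 = q.1 -> p = q by apply: zip_fun.
have fE d d' : (d, d') \in Z -> f d = d'.
  by move=> dd'; have [] := Zfun _ _ (Zf d) dd' erefl.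
have f_inj : injective f.
  move=> d d' /eqP; rewrite nth_uniq -?eq_sl ?index_mem // => /eqP.
  by apply: index_inj.
have f_rev d : f (map_rev m1 d) = map_rev m2 (f d).
  by apply: fE; apply: (bal (d, f d)).
(* The correspondence of gluings is silent about faces along the boundary; there both root faces are
   followed from their roots, and the last index is the return to the root. *)
have f_iter i : i <= (size w1).+1 ->
    f (iter i (map_face m1) (map_root m1)) = iter i (map_face m2) (map_root m2).
  rewrite leq_eqVlt => /predU1P[-> | lt_i].
    rewrite (fcycle_iter c1) eq_sw (fcycle_iter c2).
    by apply/fE/subw; rewrite /= mem_head.
  apply/fE/subw; rewrite (fcycle_consE c1) (fcycle_consE c2) -eq_sw.
  have := mem_nth (map_root m1, map_root m2)
    (_ : i < size (zip (traject (map_face m1) (map_root m1) (size w1).+1)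
                       (traject (map_face m2) (map_root m2) (size w1).+1))).
  by rewrite nth_zip ?size_traject // !nth_traject // size_zip !size_traject minnn; apply.
have f_face d : f (map_face m1 d) = map_face m2 (f d).
  have [dw|] := boolP (d \in map_root m1 :: w1); last first.
    by move=> dw; apply: fE; apply: (bph (d, f d) (Zf d)).
  move: dw; rewrite (fcycle_consE c1) => /trajectP[i lt_i ->].
  by rewrite -iterS !f_iter // ltnW.
apply/existsP; exists (perm f_inj); apply/and3P; split.
- apply/forallP => d; rewrite !permE.
  by rewrite !map_nextE // f_face f_rev.
- by apply/forallP => d; rewrite !permE f_rev.
by rewrite permE; apply/eqP/fE/subw; rewrite /= mem_head.
Qed.

Lemma encodes_rmap_iso t m1 m2 : rmap_iso m1 m2 -> encodes t m1 -> encodes t m2.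
Proof.
move=> /existsP[s /and3P[/forallP s_next /forallP s_rev /eqP s_root]].
case=> l [w [gl ul all_l cw]].
have s_face d : map_face m2 (s d) = s (map_face m1 d).
  by rewrite /map_face !permM -(eqP (s_rev d)) -(eqP (s_next _)).
exists (map s l), (map s w); rewrite -s_root -map_cons; split.
- by apply: glued_map gl => // d; rewrite (eqP (s_rev d)).
- by rewrite map_inj_uniq //; apply: perm_inj.
- by move=> d; rewrite -[d](permKV s) map_f.
by apply: homo_cycle cw => x y /= /eqP <-; rewrite s_face.
Qed.

(** The root face, read from the root, is the same word in both encodings, and the word determines
    the tree. *)
Lemma encodes_inj t1 t2 m : encodes t1 m -> encodes t2 m -> t1 = t2.
Proof.
case=> l1 [w1 [g1 u1 _ c1]] [l2 [w2 [g2 u2 _ c2]]].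
have uw1 := glued_uniq g1 u1; have uw2 := glued_uniq g2 u2.
suff E : w1 = w2 by rewrite E in g1; apply: glued_tree_inj g1 g2 u1 u2.
have eqs : size w1 = size w2.
  apply: succn_inj; rewrite -[LHS]/(size (map_root m :: w1)).
  rewrite -[RHS]/(size (map_root m :: w2)) -(card_uniqP uw1) -(card_uniqP uw2).
  apply: eq_card => d.
  by rewrite -(porbit_fcycle c1 (mem_head _ _)) (porbit_fcycle c2 (mem_head _ _)).
by have := fcycle_consE c1; rewrite eqs -(fcycle_consE c2) => -[].
Qed.

Lemma fcycle_porbit (s : {perm D}) x : fcycle s (traject s x #|porbit s x|).
Proof.
have := iter_porbit s x; case: #|_| => [|n] //; rewrite iterSr => sx.
have -> : fcycle s (traject s x n.+1) = fpath s x (rcons (traject s (s x) n) x).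
  by [].
by rewrite -[X in rcons _ X]sx -trajectSr fpath_traject.
Qed.

Lemma mem_zip_diag (l : seq D) d : d \in l -> (d, d) \in zip l l.
Proof.
elim: l => //= x l IHl; rewrite !inE => /predU1P[-> | /IHl->].
  by rewrite eqxx.
by rewrite orbT.
Qed.

Lemma card_components_map m : map_connected m ->
  #|components (map_rev m) (map_next m)| = 1.
Proof.
move=> /forallP conn.
suff -> : components (map_rev m) (map_next m) = [set setT] by rewrite cards1.
have allT x : component (map_rev m) (map_next m) x = setT.
  by apply/setP => y; rewrite !inE; have /forallP/(_ y) := conn x.
apply/setP => A; rewrite inE; apply/imsetP/eqP => [[x _ ->] // | ->].
by exists (map_root m).
Qed.

Lemma quad_disc_encodes p m : quad_disc p m -> exists t,
  [/\ valid t, half_perimeter t = p, (nb_bridges t + nb_quads t).*2 = #|D|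
    & encodes t m].
Proof.
case/and3P=> /and3P[map_m conn /eqP euler] /eqP sz /forallP quads.
have revK := is_map_revK map_m; have alT := is_map_alive map_m.
set c := traject (map_face m) (map_root m) #|porbit (map_face m) (map_root m)|.
have uc : uniq c by apply: uniq_traject_porbit.
have cc : fcycle (map_face m) c by apply: fcycle_porbit.
have memc d : (d \in c) = (d \in porbit (map_face m) (map_root m)).
  by rewrite porbit_traject.
have [t [l [gl ul _]]] : has_gluing (map_rev m) (map_next m) c.
  apply: (@planar_has_gluing _ #|edges m|) => //.
  - by rewrite alT cardsT -muln2 card_edges.
  - by rewrite card_components_map.
  move=> u d _ _; rewrite memc => dc; rewrite alT inE; split=> //.
  have := quads d; rewrite (negPf dc) /= /quad_at => /eqP d4.
  by rewrite -d4 uniq_traject_porbit fcycle_porbit.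
have fc : [seq z <- c | z \in alive (map_rev m)] = c.
  by apply/all_filterP/allP => z _; rewrite alT inE.
rewrite fc in gl; have [vt sl sc] := glued_size gl.
have /card_gt0P : exists d, d \in porbit (map_face m) (map_root m).
  by exists (map_root m); apply: porbit_id.
have [w Ec] : exists w, c = map_root m :: w.
  move: cc uc; rewrite /c; have := card_porbit_neq0 (map_face m) (map_root m).
  by case: #|_| => // n _ _ _ /=; exists (traject (map_face m) (map_face m (map_root m)) n).
(* Comparing the gluing with itself shows that its darts are closed under reversal and, off the root
   face, under the face permutation; connectedness then makes them all the darts. *)
move=> _; have [bal bph _] := glued_bisim gl gl ul.
have all_l d : d \in l.
  have l_rev x : x \in l -> map_rev m x \in l.
    by move/mem_zip_diag/bal/mem_zip1.
  have l_face x : x \in l -> map_face m x \in l.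
    move=> xl; have [xc | xc] := boolP (x \in c); last first.
      exact: (mem_zip1 (bph _ (mem_zip_diag xl) xc)).
    by apply: (glued_sub gl); apply: (mem_fcycle cc).
  have rootl : map_root m \in l by apply: (glued_sub gl); rewrite Ec mem_head.
  have /forallP/(_ (map_root m))/forallP/(_ d) link := conn.
  apply: (@linked_closed _ (map_rev m) (map_next m) (mem l)) link rootl => x xl.
    exact: l_rev.
  by rewrite /= map_nextE //; apply/l_face/l_rev.
exists t; split=> //.
- by apply: double_inj; rewrite -sc size_traject sz.
- by rewrite -sl -(card_uniqP ul); apply: eq_card => d; rewrite all_l.
by exists l, w; rewrite -Ec.
Qed.

Lemma encodes_ex t : valid t -> 0 < half_perimeter t ->
  #|D| = (nb_bridges t + nb_quads t).*2 ->
  exists m, quad_disc (half_perimeter t) m /\ encodes t m.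
Proof.
move=> vt ht cardD; have ul := enum_uniq D; set l := enum D in ul.
have sl : size l = (nb_bridges t + nb_quads t).*2 by rewrite -cardE.
have all_l d : d \in l by rewrite mem_enum.
have [w [P [Q [[pP pQ sw] P2 Q4 sQ gl]]]] := tree_polygons vt ul sl.
have uP : uniq (flatten P) by rewrite (perm_uniq pP).
have uwQ : uniq (flatten (w :: Q)) by rewrite (perm_uniq pQ).
have [al cycP] := perm_of_cycles uP; have [ph cycQ] := perm_of_cycles uwQ.
have cw := cycQ _ (mem_head _ _).
have {}gl : glued al ph t l w.
  by apply: gl => // c cQ; apply: cycQ; rewrite inE cQ orbT.
have alK : involutive al.
  move=> d; have : d \in flatten P by rewrite (perm_mem pP).
  case/flattenP=> c cP; have := cycP c cP; have := P2 c cP.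
  case: c {cP} => [|x [|y []]] //= _ /and3P[/eqP xy /eqP yx _].
  by rewrite !inE => /orP[] /eqP ->; rewrite ?xy ?yx ?xy.
have mov := glued_moves gl ul; have uw := glued_uniq gl ul.
case: w sw gl uw cw uwQ cycQ pQ => [|r w] sw gl uw cw uwQ cycQ pQ.
  by move: sw ht; case: half_perimeter.
pose m : rmap D := ((al * ph)%g, al, r); exists m.
have faceE : map_face m = ph.
  by apply/permP => d; rewrite /map_face /map_next /map_rev /= !permM alK.
have map_m : is_map m.
  by apply/forallP => d; rewrite /map_rev /= alK eqxx mov.
split; last by exists l, w; rewrite faceE.
have linkr d : linked al (al * ph)%g r d.
  have faceL : (al * (al * ph))%g = ph by apply/permP => z; rewrite !permM alK.
  have cl := glued_closed gl (P := linked al (al * ph)%g r).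
  apply: cl (all_l d) => [x rx|x rx|x xw].
  - exact: linked_trans rx (linked_rev _ _ _).
  - by rewrite -{2}faceL; apply: linked_trans rx (linked_face _ _ _).
  by apply: (@linked_fcycle _ _ _ (r :: w)); rewrite ?faceL ?mem_head.
have orb_r : porbit ph r =i r :: w by apply: porbit_fcycle cw (mem_head _ _).
have faces_m : #|porbits ph| = (nb_quads t).+1.
  rewrite -sQ (card_porbits_cycles (cs := (r :: w) :: Q)) //.
    move=> c cQ; split; first exact: cycQ.
    by move: cQ; rewrite inE => /predU1P[-> // | /Q4]; case: c.
  by move=> d; rewrite (perm_mem pQ) all_l.
have alive_w : [seq z <- r :: w | z \in alive al] = r :: w.
  by apply/all_filterP/allP => z _; rewrite inE mov.
(* Once all edges are deleted the reversal is the identity, so the face permutation has become the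
   vertex permutation. The balance of splits and merges thereby counts the vertices, which gives
   Euler's relation. *)
have [al' [ph' [_ al'E _ eq_v n_v]]] := glued_unglue gl alK ul uw cw alive_w.
have al'1 : al' = 1%g by apply/permP => d; rewrite al'E all_l perm1.
rewrite al'1 mul1g in eq_v; rewrite eq_v faces_m in n_v.
apply/and3P; split.
- apply/and3P; split=> //.
    apply/forallP => d1; apply/forallP => d2.
    by apply: linked_trans (linkr d2); rewrite linked_sym.
  have := card_edges map_m; rewrite cardD -muln2 => /eqP.
  rewrite eqn_pmul2r // => /eqP ->.
  rewrite /vertices /faces faceE faces_m /map_next /=.
  have -> : #|porbits (al * ph)%g| = (nb_bridges t).+1.
    by apply: (@addIn (nb_quads t)); rewrite n_v addSnnS addnC.
  by rewrite addSn addnS addn2.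
- by rewrite faceE (eq_card orb_r) (card_uniqP uw) sw.
apply/forallP => d; rewrite faceE orb_r.
have : d \in flatten ((r :: w) :: Q) by rewrite (perm_mem pQ).
rewrite mem_cat => /orP[-> // | /flattenP[c cQ dc]].
have cc : fcycle ph c by apply: cycQ; rewrite inE cQ orbT.
have uc : uniq c by apply: uniq_flatten_mem uwQ _; rewrite inE cQ orbT.
by rewrite (eq_card (porbit_fcycle cc dc)) (card_uniqP uc) Q4 // eqxx orbT.
Qed.

End Encoding.

(** * Counting trees *)

HB.instance Definition _ := gen_eqMixin tutte_tree.

(** Each class is the set of discs encoded by one tree: all discs have a tree, all listed trees are
    realized, and maps are isomorphic exactly when they share a tree. *)
Lemma card_quad_discs (D : finType) p (ts : seq tutte_tree) :
  0 < p -> uniq ts ->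
  (forall t, (t \in ts) = [&& valid t, half_perimeter t == p
                           & (nb_bridges t + nb_quads t).*2 == #|D|]) ->
  #|equivalence_partition (@rmap_iso D) [set m | quad_disc p m]| = size ts.
Proof.
move=> p_gt0 uts mem_ts.
pose block t := [set m : rmap D | quad_disc p m & `[< encodes t m >]].
have blockE t m : m \in block t ->
    block t = [set m' in [set m | quad_disc p m] | rmap_iso m m'].
  rewrite inE => /andP[dm /asboolP tm]; apply/setP => m'; rewrite !inE.
  case dm': (quad_disc p m') => //=; apply/asboolP/idP; last first.
    by move=> iso; apply: encodes_rmap_iso tm.
  by apply: encodes_iso tm; [case/and3P: dm => /and3P[] | case/and3P: dm' => /and3P[]].
have block_ex t : t \in ts -> exists m, m \in block t.
  rewrite mem_ts => /and3P[vt /eqP ht /eqP et].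
  have ht0 : 0 < half_perimeter t by rewrite ht.
  have [m [dm tm]] := encodes_ex vt ht0 (esym et); rewrite ht in dm.
  by exists m; rewrite inE dm; apply/asboolP.
rewrite -(size_map block); transitivity #|map block ts|.
  apply: eq_card => B; apply/imsetP/mapP => [[m] | [t tts ->]].
    rewrite inE => dm ->; have [t [vt ht et tm]] := quad_disc_encodes dm.
    exists t; first by rewrite mem_ts vt ht et !eqxx.
    by rewrite -(blockE t) // inE dm; apply/asboolP.
  have [m mt] := block_ex t tts; exists m; last exact: blockE.
  by move: mt; rewrite !inE => /andP[].
apply/card_uniqP; rewrite map_inj_in_uniq // => t1 t2 t1ts _ eqb.
have [m mt1] := block_ex t1 t1ts; have := mt1; rewrite {1}eqb.
move: mt1; rewrite !inE => /andP[_ /asboolP m1] /andP[_ /asboolP m2].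
exact: encodes_inj m1 m2.
Qed.

Definition bridge_trees (F : nat -> nat -> seq tutte_tree) f p :=
  flatten [seq [seq Bridge a b | a <- F i.1 i.2, b <- F (f - i.1) (p - i.2)]
          | i <- [seq (i, j) | i <- iota 0 f.+1, j <- iota 0 p.+1]].

Definition quad_trees (F : nat -> nat -> seq tutte_tree) f p :=
  if f is f'.+1 then map Quad (F f' p.+2) else [::].

(** [n] is fuel. A [Quad] trades one face for one more unit of half-perimeter, so [f.*2 + p]
    decreases at every step and bounds the fuel that is needed. *)
Fixpoint trees n f p : seq tutte_tree :=
  if n is n'.+1 then
    if p is p'.+1 then bridge_trees (trees n') f p' ++ quad_trees (trees n') f p'
    else if f == 0 then [:: Vertex] else [::]
  else if (f == 0) && (p == 0) then [:: Vertex] else [::].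

Lemma treesS n f p : trees n.+1 f p.+1 =
  bridge_trees (trees n) f p ++ quad_trees (trees n) f p.
Proof. by []. Qed.

Lemma bridge_treesP F f p t :
  reflect (exists i j a b, [/\ i <= f, j <= p, a \in F i j,
                              b \in F (f - i) (p - j) & t = Bridge a b])
          (t \in bridge_trees F f p).
Proof.
apply: (iffP flattenP) => [[_ /mapP[_ /allpairsP[[i j] [ilt jlt ->]] ->]]|].
  case/allpairsP=> [[a b] [aF bF ->]]; exists i, j, a, b; split=> //.
    by move: ilt; rewrite mem_iota.
  by move: jlt; rewrite mem_iota.
case=> i [j [a [b [ilt jlt aF bF ->]]]].
exists [seq Bridge a b | a <- F i j, b <- F (f - i) (p - j)].
  apply/mapP; exists (i, j) => //; apply/allpairsP; exists (i, j).
  by split; rewrite ?mem_iota.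
by apply/allpairsP; exists (a, b).
Qed.

Lemma mem_trees n f p t : f.*2 + p <= n ->
  (t \in trees n f p) = [&& valid t, nb_quads t == f & half_perimeter t == p].
Proof.
elim: n f p t => [|n IHn] f p t.
  rewrite leqn0 addn_eq0 double_eq0 => /andP[/eqP -> /eqP ->] /=.
  rewrite inE; apply/eqP/idP => [-> // | /and3P[vt q0 h0]].
  by case: t vt q0 h0 => //= a /andP[]; case: half_perimeter => // -[].
case: p => [|p] lt.
  rewrite /=; apply/idP/idP.
    by case: (f =P 0) => // ->; rewrite inE => /eqP ->.
  case: t => [|a b|a] /=.
  - by case/andP => /eqP <- _; rewrite inE.
  - by case/and3P.
  by case/and3P => /andP[]; case: half_perimeter => // -[].
rewrite treesS mem_cat; apply/orP/idP.
  case=> [/bridge_treesP[i [j [a [b [lt_i lt_j aF bF ->]]]]]|].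
    move: aF bF; rewrite !IHn; try lia; move=> /and3P[va /eqP qa /eqP ha].
    by case/and3P=> [vb /eqP qb /eqP hb] /=; rewrite va vb; lia.
  case: f lt => // f lt /mapP[a + ->]; rewrite IHn; last lia.
  by case/and3P=> /= -> /eqP -> /eqP ->; rewrite !eqxx.
case: t => [|a b|a]; first by case/and3P.
  case/and3P=> vab /eqP qf /eqP[hp]; left; rewrite /= in vab qf.
  case/andP: vab => va vb; apply/bridge_treesP.
  exists (nb_quads a), (half_perimeter a), a, b; split=> //; try lia.
    by rewrite IHn ?va ?eqxx //; lia.
  rewrite IHn ?vb /=; last lia.
  by apply/andP; split; apply/eqP; lia.
case/and3P=> vqa /eqP qf /eqP hp; right; rewrite /= in vqa qf hp.
case/andP: vqa => ha va; case: f qf lt => // f [qf] lt.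
rewrite [_ \in _]map_f // IHn ?va /=; last lia.
by apply/andP; split; apply/eqP; lia.
Qed.

Lemma uniq_flatten_key (I : eqType) (T : eqType) (k : T -> I) (F : I -> seq T)
    (r : seq I) : uniq r -> (forall i, i \in r -> uniq (F i)) ->
  (forall i x, i \in r -> x \in F i -> k x = i) ->
  uniq (flatten (map F r)).
Proof.
elim: r => //= i r IHr /andP[ir ur] uF kF; rewrite cat_uniq uF ?mem_head //.
have -> : uniq (flatten (map F r)).
  by apply: IHr => // [j jr | j x jr]; [apply: uF | apply: kF]; rewrite inE jr orbT.
rewrite andbT; apply/hasPn => x /flattenP[_ /mapP[j jr ->] xj]; apply/negP => xi.
move: ir; rewrite -(kF i x (mem_head _ _) xi) (kF j x) ?jr //.
by rewrite inE jr orbT.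
Qed.

Lemma trees_uniq n f p : f.*2 + p <= n -> uniq (trees n f p).
Proof.
elim: n f p => [|n IHn] f p lt; first by rewrite /=; case: ifP.
case: p lt => [|p] lt; first by rewrite /=; case: ifP.
rewrite treesS cat_uniq; apply/and3P; split.
(* The sizes of the left subtree tell from which block of the enumeration a tree comes. *)
- pose k t := if t is Bridge a b then (nb_quads a, half_perimeter a) else (0, 0).
  apply: (uniq_flatten_key (k := k)).
  + by apply: allpairs_uniq; rewrite ?iota_uniq // => -[? ?] [].
  + move=> _ /allpairsP[[i j] [lt_i lt_j ->]]; move: lt_i lt_j.
    rewrite !mem_iota => lt_i lt_j.
    apply: allpairs_uniq; try by apply: IHn; move: lt_i lt_j => /=; lia.
    by move=> [a b] [a' b'] _ _ /= [-> ->].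
  move=> _ t /allpairsP[[i j] [lt_i lt_j ->]]; move: lt_i lt_j.
  rewrite !mem_iota => lt_i lt_j /allpairsP[[a b] [+ _ ->]].
  rewrite mem_trees; last by move: lt_i lt_j => /=; lia.
  by case/and3P=> _ /eqP qa /eqP ha; rewrite /k qa ha.
- case: f lt => // f lt; apply/hasPn => _ /mapP[a _ ->]; apply/negP.
  by case/bridge_treesP=> [? [? [? [? []]]]].
case: f lt => // f lt; rewrite map_inj_uniq; last by move=> ? ? [].
by apply: IHn; lia.
Qed.

Definition nb_discs f p := size (trees (f.*2 + p) f p).

Lemma size_trees n f p : f.*2 + p <= n -> size (trees n f p) = nb_discs f p.
Proof.
move=> le_n; apply/perm_size/uniq_perm; rewrite ?trees_uniq // => t.
by rewrite !mem_trees.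
Qed.

Lemma nb_discs0 f : nb_discs f 0 = (f == 0).
Proof.
rewrite -(@size_trees (f.*2).+1) ?addn0 //=.
by case: eqP.
Qed.

Lemma nb_discsS f p : nb_discs f p.+1 =
  \sum_(i < f.+1) \sum_(j < p.+1) nb_discs i j * nb_discs (f - i) (p - j)
  + (if f is f'.+1 then nb_discs f' p.+2 else 0).
Proof.
rewrite {1}/nb_discs addnS treesS size_cat; congr (_ + _).
  rewrite size_flatten /shape -map_comp sumnE big_map big_allpairs_dep /=.
  rewrite -[0 :: iota 1 f]/(index_iota 0 f.+1) big_mkord.
  apply: eq_bigr => -[i /= lt_i] _.
  rewrite -[0 :: iota 1 p]/(index_iota 0 p.+1) big_mkord.
  apply: eq_bigr => -[j /= lt_j] _.
  by rewrite size_allpairs !size_trees //; lia.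
case: f => // f; rewrite size_map size_trees //; lia.
Qed.

(** * Quadrangulations as discs *)

Lemma card_porbits_uniform (D : finType) (s : {perm D}) k :
  (forall d, #|porbit s d| = k) -> #|porbits s| * k = #|D|.
Proof.
move=> sk; have : partition (porbits s) [set: D].
  have -> : porbits s = orbit 'P <[s]> @: [set: D].
    by apply/setP => A; apply/imsetP/imsetP => -[d _ ->]; exists d; rewrite ?porbitE.
  by apply: orbit_partition; apply/actsP => a _ d; rewrite !inE.
move/card_uniform_partition=> /(_ k) <-; first by rewrite cardsT.
by move=> _ /imsetP[d _ ->].
Qed.

Lemma nb_edges_rmap e (m : rmap 'I_(e.*2)) : is_map m -> #|edges m| = e.
Proof. by move=> /card_edges; rewrite card_ord muln2 => /double_inj. Qed.

(** With all faces of degree 4, 4F = 2E turns Euler's relation into E = 2(V - 2), so the number of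
    vertices fixes that of darts. *)
Lemma quadrangulationE n e (m : rmap 'I_(e.*2)) :
  quadrangulation m && (#|vertices m| == n.+3) = (e == n.+1.*2) && quad_disc 2 m.
Proof.
rewrite /quadrangulation /quad_disc.
have [pm | //] /= := boolP (planar_map m); last by rewrite andbF.
have /and3P[map_m _ /eqP euler] := pm; rewrite (nb_edges_rmap map_m) in euler.
have uni : (forall d, #|porbit (map_face m) d| = 4) -> #|faces m| * 4 = e.*2.
  by move/card_porbits_uniform; rewrite card_ord.
apply/andP/and3P => [[/orP[/forall_inP f4|/andP[/eqP->]] /eqP V] // | ].
  have f4' d : #|porbit (map_face m) d| = 4 by apply/eqP/f4/imset_f.
  split.
  - move: euler V (uni f4'); move: #|vertices m| #|faces m| => v f; clear; lia.
  - by rewrite f4'.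
  by apply/forallP => d; rewrite f4' eqxx orbT.
case=> /eqP e_n /eqP r4 /forallP f4.
have f4' d : #|porbit (map_face m) d| = 4.
  case/orP: (f4 d) => [|/eqP //]; rewrite -eq_porbit_mem => /eqP ->.
  by rewrite r4.
split.
  by apply/orP; left; apply/forall_inP => _ /imsetP[d _ ->]; rewrite f4'.
by move: euler (uni f4'); move: #|vertices m| #|faces m| => v f; rewrite e_n; clear; lia.
Qed.

(** For V = 2 Euler's relation gives F = E, whereas quadrangles would give 2F = E; the root dart
    excludes E = 0. Only the conventional single edge remains, whose unique face has degree 2. *)
Lemma quadrangulation2E e (m : rmap 'I_(e.*2)) :
  quadrangulation m && (#|vertices m| == 2) = (e == 1) && quad_disc 1 m.
Proof.
rewrite /quadrangulation /quad_disc.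
have [pm | //] /= := boolP (planar_map m); last by rewrite andbF.
have /and3P[map_m _ /eqP euler] := pm; rewrite (nb_edges_rmap map_m) in euler *.
have e_gt0 : 0 < e by case: (m) => _; case: e {m pm map_m euler} => // -[].
have one_face : (#|faces m| == 1) = (#|porbit (map_face m) (map_root m)| == e.*2).
  have rf : porbit (map_face m) (map_root m) \in faces m by apply: imset_f.
  apply/eqP/eqP => [F1 | r1].
    have cT : #|[set: 'I_(e.*2)]| = e.*2 by rewrite cardsT card_ord.
    rewrite -[RHS]cT; congr #|pred_of_set _|; apply/setP => d; rewrite inE.
    move: rf; have /cards1P[A EA] : #|faces m| == 1 by rewrite F1.
    have : porbit (map_face m) d \in faces m by apply: imset_f.
    rewrite EA !inE -eq_porbit_mem.
    by move=> /eqP -> /eqP ->; rewrite eqxx.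
  have rT : porbit (map_face m) (map_root m) = setT.
    by apply/eqP; rewrite eqEcard subsetT cardsT card_ord r1 leqnn.
  apply/eqP/cards1P; exists setT; apply/setP => A; rewrite inE.
  apply/imsetP/eqP => [[d _ ->] | ->]; last by exists (map_root m).
  by apply/eqP; rewrite -rT eq_porbit_mem rT inE.
apply/andP/and3P => [[/orP[/forall_inP f4|/andP[_ /eqP e1]] /eqP V] // | ].
  have f4' d : #|porbit (map_face m) d| = 4 by apply/eqP/f4/imset_f.
  have := card_porbits_uniform f4'; rewrite card_ord -/(faces m).
  move: euler V; move: #|vertices m| #|faces m| => v f; move: e_gt0; clear; lia.
- have F1 : #|faces m| == 1.
    by move: euler; rewrite V; move: #|faces m| => f; rewrite e1; lia.
  have /cards1P[A EA] := F1; split; first exact/eqP.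
    by move: F1; rewrite one_face; move: #|porbit _ _| => k; rewrite e1.
  apply/forallP => d; apply/orP; left.
  have : porbit (map_face m) d \in faces m by apply: imset_f.
  have : porbit (map_face m) (map_root m) \in faces m by apply: imset_f.
  by rewrite EA !inE -eq_porbit_mem => /eqP -> /eqP ->.
case=> /eqP e1 /eqP r2 _.
have /eqP F1 : #|faces m| == 1 by rewrite one_face r2 e1.
have V2 : #|vertices m| = 2.
  by move: euler; rewrite F1; move: #|vertices m| => v; rewrite e1; lia.
by rewrite V2 !eqxx; split=> //; apply/orP; right; apply/eqP.
Qed.

Lemma nb_quadrangulationsE n : nb_quadrangulations n.+2 = nb_discs n 1.
Proof.
have partition0 (T : finType) (r : rel T) : #|equivalence_partition r set0| = 0.
  by rewrite /equivalence_partition imset0 cards0.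
pose A e := [set m : rmap 'I_(e.*2) | quadrangulation m & #|vertices m| == n.+2].
have [e0 [lt_e0 A0 Ae]] : exists e0, [/\ e0 < n.+2.*2,
    #|equivalence_partition (@rmap_iso 'I_(e0.*2)) (A e0)| = nb_discs n 1 &
    forall e, e != e0 -> A e = set0].
  case: n @A => [|n] A.
    exists 1; split=> // [|e /negPf ne]; last first.
      by apply/setP => m; rewrite !inE quadrangulation2E ne.
    have -> : A 1 = [set m | quad_disc 1 m].
      by apply/setP => m; rewrite !inE quadrangulation2E.
    apply: card_quad_discs; rewrite ?trees_uniq // => t; rewrite mem_trees // card_ord.
    by case vt: (valid t) => //=; rewrite (nb_edges_valid vt); lia.
  exists n.+1.*2; split=> [||e /negPf ne]; first by lia.
    have -> : A n.+1.*2 = [set m | quad_disc 2 m].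
      by apply/setP => m; rewrite !inE quadrangulationE eqxx.
    (* With half-perimeter 1, a root bridge would leave two discs of perimeter 0, which have no
       inner face. So the root edge borders a quadrangle, and deleting it gives perimeter 4. *)
    have -> : nb_discs n.+1 1 = nb_discs n 2.
      rewrite nb_discsS big1 // => i _; rewrite big_ord1 !nb_discs0.
      by case: i => -[|i] //= _; rewrite muln0.
    apply: card_quad_discs; rewrite ?trees_uniq // => t; rewrite mem_trees // card_ord.
    by case vt: (valid t) => //=; rewrite (nb_edges_valid vt); lia.
  by apply/setP => m; rewrite !inE quadrangulationE ne.
rewrite /nb_quadrangulations (bigD1 (Ordinal lt_e0)) //= A0 big1 ?addn0 // => e ne.
by rewrite -/(A e) Ae ?partition0 //.
Qed.

(** * Generating functions *)

Local Open Scope ring_scope.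

Section FpsCoefficients.
Variable R : fieldType.
Implicit Types f g : fps R.

Lemma fps_addE f g n : (f + g) n = f n + g n. Proof. by []. Qed.

Lemma fps_oppE f n : (- f) n = - f n. Proof. by []. Qed.

Lemma fps_mulE f g n : (f * g) n = \sum_(i < n.+1) f i * g (n - i)%N.
Proof. by []. Qed.

Lemma fps_oneE n : (1 : fps R) n = (n == 0%N)%:R. Proof. by []. Qed.

Lemma fps_sumE I (r : seq I) (F : I -> fps R) n :
  (\sum_(i <- r) F i) n = \sum_(i <- r) F i n.
Proof. by elim/big_rec2: _ => // i y1 y2 _ <-. Qed.

Lemma fps_muln f n k : (f *+ k) n = f n *+ k.
Proof. by elim: k => // k IHk; rewrite !mulrS fps_addE IHk. Qed.

Lemma fps_natmulE k f n : (k%:R * f) n = k%:R * f n.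
Proof. by rewrite !mulr_natl fps_muln. Qed.

Lemma fps_XmulE f n : (fps_X * f) n = if n is n'.+1 then f n' else 0.
Proof.
rewrite fps_mulE; case: n => [|n]; first by rewrite big_ord1 mul0r.
rewrite !big_ord_recl /= mul0r add0r mul1r subn1 /=.
by rewrite big1 ?addr0 // => i _; rewrite mul0r.
Qed.

Lemma fps_divXE f n : fps_divX f n = f n.+1. Proof. by []. Qed.

Lemma fps_XdivX f : fps_divX (fps_X * f) = f.
Proof. by apply: fpsP => n; rewrite fps_divXE fps_XmulE. Qed.

End FpsCoefficients.

(** * Pointing, and the equation compared with the recursion *)

Lemma pointedE F n : pointed F n = n%:R * F n.
Proof. by rewrite /pointed fps_XmulE; case: n => [|n]; rewrite ?mul0r. Qed.

Lemma pointedD F G : pointed (F + G) = pointed F + pointed G.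
Proof. by apply: fpsP => n; rewrite pointedE !fps_addE !pointedE mulrDr. Qed.

Lemma pointedM F G : pointed (F * G) = pointed F * G + F * pointed G.
Proof.
apply: fpsP => n; rewrite pointedE fps_addE !fps_mulE big_distrr -big_split.
apply: eq_bigr => i _; rewrite !pointedE.
have -> : n%:R = i%:R + (n - i)%:R :> rat.
  by rewrite -natrD subnKC // -ltnS.
by rewrite /=; ring.
Qed.

Lemma pointed_natmul k F : pointed (k%:R * F) = k%:R * pointed F.
Proof.
by apply: fpsP => n; rewrite pointedE !fps_natmulE pointedE mulrCA.
Qed.

Lemma pointedX : pointed fps_X = fps_X.
Proof.
by apply: fpsP => -[|[|n]]; rewrite pointedE /= ?mul0r ?mul1r ?mulr0.
Qed.

Lemma fps_one_sub_unit (F : fps rat) : F 0%N = 0 -> 1 - F \is a GRing.unit.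
Proof.
by move=> F0; rewrite fps_unitE fps_addE fps_oppE F0 subr0 fps_oneE oner_eq0.
Qed.

Lemma quad_equationE F : in_x2 F -> quad_equation F <->
  pointed F - pointed F * fps_divX (pointed F) =
  2%:R * (fps_X * (fps_X * 1)) - 2%:R * (fps_X * (fps_X * fps_divX (pointed F)))
  + 6%:R * (fps_X * (pointed F - F)).
Proof.
case=> F0 F1; rewrite /quad_equation; set P := pointed F; set D := fps_divX P.
have unitD : 1 - D \is a GRing.unit.
  by apply: fps_one_sub_unit; rewrite fps_divXE pointedE F1 mulr0.
have -> : (P = 2%:R * fps_X ^+ 2 + 6%:R * fps_X * ((P - F) / (1 - D))) <->
    P * (1 - D) = (2%:R * fps_X ^+ 2 + 6%:R * fps_X * ((P - F) / (1 - D))) * (1 - D).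
  by split=> [<- // | /(mulIr unitD)].
have -> : P * (1 - D) = P - P * D by ring.
suff -> : (2%:R * fps_X ^+ 2 + 6%:R * fps_X * ((P - F) / (1 - D))) * (1 - D) =
    2%:R * (fps_X * (fps_X * 1)) - 2%:R * (fps_X * (fps_X * D))
    + 6%:R * (fps_X * (P - F)) by [].
transitivity (2%:R * fps_X ^+ 2 * (1 - D)
              + 6%:R * fps_X * (P - F) * ((1 - D)^-1 * (1 - D))); first by ring.
by rewrite mulVr //; ring.
Qed.

Lemma quad_equation_recursion F : in_x2 F -> quad_equation F <-> quad_recursion F.
Proof.
move=> x2F; rewrite quad_equationE //; have [F0 F1] := x2F.
set P := pointed F; set D := fps_divX P.
have P0 : P 0%N = 0 by rewrite pointedE F0 mulr0.
have P1 : P 1%N = 0 by rewrite pointedE F1 mulr0.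
have PE n : P n = n%:R * F n by rewrite pointedE.
have DE n : D n = P n.+1 by rewrite fps_divXE.
clearbody D; clearbody P.
pose lhs := P - P * D.
pose rhs : fps rat := 2%:R * (fps_X * (fps_X * 1)) - 2%:R * (fps_X * (fps_X * D))
  + 6%:R * (fps_X * (P - F)).
(* The terms of index 0, 1 and m vanish, because the coefficients of [P] of degree 0 and 1 do. *)
have PD m : (2 <= m)%N ->
    (P * D) m = \sum_(2 <= k < m) k%:R * (m.+1 - k)%:R * F k * F (m.+1 - k)%N.
  move=> m2; rewrite fps_mulE -(big_mkord xpredT (fun i => P i * D (m - i)%N)).
  rewrite big_ltn // big_ltn ?ltnS 1?ltnW // P0 P1 !mul0r !add0r.
  rewrite big_nat_recr // subnn DE P1 mulr0 [LHS]addr0 !big_nat.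
  apply: eq_bigr => k /andP[_ lt_km]; rewrite DE !PE -subSn ?(ltnW lt_km) //.
  by ring.
have lhsE n : lhs n.+3 = n.+3%:R * F n.+3
    - \sum_(2 <= k < n.+3) k%:R * (n.+4 - k)%:R * F k * F (n.+4 - k)%N.
  by rewrite /lhs fps_addE fps_oppE PD // PE.
(* For m = n + 2 the coefficient is -2m + 6(m - 1) = 4(m + 1) - 10; the natural subtraction is not
   truncated from index 3 on. *)
have rhsE n : rhs n.+3 = (4 * n.+3 - 10)%:R * F n.+2.
  rewrite /rhs !fps_addE fps_oppE !fps_natmulE !fps_XmulE fps_oneE DE.
  rewrite fps_addE fps_oppE !PE.
  have -> : (4 * n.+3 - 10 = 4 * n + 2)%N by lia.
  have -> : n.+2%:R = n%:R + 2%:R :> rat by rewrite -natrD addn2.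
  have -> : (n.+1 == 0%N)%:R = 0 :> rat by [].
  by rewrite natrD natrM; ring.
have low : (lhs = rhs) <-> F 2%N = 1 /\ forall n, lhs n.+3 = rhs n.+3.
  have l2 : lhs 2%N = 2%:R * F 2%N.
    by rewrite /lhs fps_addE fps_oppE PD // big_geq // subr0 PE.
  have r2 : rhs 2%N = 2%:R.
    rewrite /rhs !fps_addE fps_oppE !fps_natmulE !fps_XmulE fps_oneE DE P1.
    have -> : (0%N == 0%N)%:R = 1 :> rat by [].
    by rewrite fps_addE fps_oppE P1 F1; ring.
  split=> [E | [F2 E]]; first split.
  - by apply: (@mulfI _ 2%:R) => //; rewrite mulr1 -l2 -r2 E.
  - by move=> n; rewrite E.
  apply: fpsP => -[|[|[|n]]] //; last by rewrite l2 r2 F2 mulr1.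
    rewrite /lhs /rhs !fps_addE !fps_oppE !fps_natmulE !fps_XmulE fps_mulE.
    by rewrite big_ord1 P0 mul0r; ring.
  have PD1 : (P * D) 1%N = 0.
    rewrite fps_mulE -(big_mkord xpredT (fun i => P i * D (1 - i)%N)).
    by rewrite big_ltn // big_ltn // big_geq // P0 P1 !mul0r !addr0.
  rewrite /lhs /rhs fps_addE fps_oppE PD1 !fps_addE !fps_oppE !fps_natmulE.
  by rewrite !fps_XmulE fps_addE fps_oppE P0 P1 F0; ring.
rewrite -/lhs -/rhs low /quad_recursion.
split=> -[F2 rec]; split=> //.
  case=> [|[|[|n]]] // _; have := rec n; rewrite lhsE rhsE => /eqP.
  by rewrite subr_eq addrC => /eqP.
by move=> n; rewrite lhsE rhsE rec // addrAC subrr add0r.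
Qed.

(** On the right of the recursion for n all indices lie below n, and n is invertible in the
    rationals. *)
Lemma quad_recursion_inj (F G : fps rat) : in_x2 F -> in_x2 G ->
  quad_recursion F -> quad_recursion G -> F = G.
Proof.
move=> [F0 F1] [G0 G1] [F2 recF] [G2 recG]; apply: fpsP => n.
elim/ltn_ind: n => -[|[|[|n]]] IHn; rewrite ?F0 ?F1 ?F2 ?G0 ?G1 ?G2 //.
have n_neq0 : n.+3%:R != 0 :> rat by rewrite pnatr_eq0.
apply: (mulfI n_neq0); rewrite recF // recG // IHn //; congr (_ + _).
rewrite !big_nat; apply: eq_bigr => k /andP[k2 lt_k].
by rewrite !IHn //; lia.
Qed.

(** * Solving the recursion for discs *)

Definition disc_series p : fps rat := Fps (fun f => (nb_discs f p)%:R).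

Lemma disc_series0 : disc_series 0%N = 1.
Proof. by apply: fpsP => f; rewrite fps_oneE -nb_discs0. Qed.

Lemma disc_seriesS p : disc_series p.+1 =
  \sum_(i < p.+1) disc_series i * disc_series (p - i) + fps_X * disc_series p.+2.
Proof.
apply: fpsP => f; rewrite fps_addE fps_sumE fps_XmulE.
have -> : disc_series p.+1 f = (nb_discs f p.+1)%:R by [].
rewrite nb_discsS natrD; congr (_ + _); last by case: f.
rewrite exchange_big natr_sum; apply: eq_bigr => i _.
by rewrite fps_mulE natr_sum; apply: eq_bigr => j _; rewrite natrM.
Qed.

Lemma disc_recursion_inj (U V : nat -> fps rat) :
  (forall p, U p.+1 = \sum_(i < p.+1) U i * U (p - i)%N + fps_X * U p.+2) ->
  (forall p, V p.+1 = \sum_(i < p.+1) V i * V (p - i)%N + fps_X * V p.+2) ->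
  U 0%N = V 0%N -> U =1 V.
Proof.
move=> recU recV UV0 p; apply: fpsP => f.
have [n] := ubnP (f.*2 + p); elim: n f p => // n IHn f [|p] lt.
  by rewrite UV0.
rewrite recU recV !fps_addE !fps_sumE !fps_XmulE; congr (_ + _).
  apply: eq_bigr => i _; have := ltn_ord i; rewrite !fps_mulE => lt_i.
  apply: eq_bigr => j _; have := ltn_ord j => lt_j.
  by rewrite !IHn //; lia.
by case: f lt => // f lt; apply: IHn; lia.
Qed.

(** A disc without inner faces is a plane tree with p edges. The number is taken as a constant power
    series, so that it can enter ring identities. *)
Definition catalan p : fps rat := (nb_discs 0 p)%:R.

Lemma catalan0 : catalan 0%N = 1. Proof. by rewrite /catalan nb_discs0. Qed.

Lemma catalanS p : catalan p.+1 = \sum_(i < p.+1) catalan i * catalan (p - i)%N.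
Proof.
rewrite /catalan nb_discsS addn0 big_ord1 natr_sum.
by apply: eq_bigr => i _; rewrite natrM.
Qed.

(** This and the next two convolutions are the Catalan recurrence with its end terms removed. They
    express products of shifted sequences linearly, so that the form A c_p + B c_{p+1} is compatible
    with convolution. *)
Lemma catalan_shift1 p :
  \sum_(i < p.+1) catalan i * catalan (p - i).+1 = catalan p.+2 - catalan p.+1.
Proof.
rewrite [catalan p.+2]catalanS [in RHS]big_ord_recr /= subnn catalan0 mulr1 addrK.
by apply: eq_bigr => i _; rewrite subSn // -ltnS.
Qed.

Lemma catalan_shift1' p :
  \sum_(i < p.+1) catalan i.+1 * catalan (p - i)%N = catalan p.+2 - catalan p.+1.
Proof.
by rewrite [catalan p.+2]catalanS [in RHS]big_ord_recl /= subn0 catalan0 mul1r addrAC subrr add0r.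
Qed.

Lemma catalan_shift2 p :
  \sum_(i < p.+1) catalan i.+1 * catalan (p - i).+1 = catalan p.+3 - catalan p.+2 - catalan p.+2.
Proof.
rewrite [catalan p.+3]catalanS [in RHS]big_ord_recl [in RHS]big_ord_recr /=.
rewrite subn0 subnn catalan0 mul1r mulr1.
have cancel (c s : fps rat) : c + (s + c) - c - c = s by ring.
rewrite /bump /= cancel; apply: eq_bigr => i _.
by rewrite subSn // -ltnS.
Qed.

(** The Catalan generating function at 3x. *)
Definition tree_series : fps rat := Fps (fun n => (3 ^ n * nb_discs 0 n)%:R).

Lemma tree_seriesE :
  tree_series = 1 + 3%:R * (fps_X * (tree_series * tree_series)).
Proof.
apply: fpsP => n; rewrite fps_addE fps_natmulE fps_XmulE fps_oneE.
case: n => [|n].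
  by rewrite mulr0 addr0.
have -> : (n.+1 == 0%N)%:R = 0 :> rat by [].
rewrite add0r fps_mulE.
have -> : tree_series n.+1 = (3 ^ n.+1 * nb_discs 0 n.+1)%:R by [].
rewrite nb_discsS addn0 big_ord1 expnS -mulnA natrM; congr (_ * _).
rewrite big_distrr natr_sum; apply: eq_bigr => i _ /=.
rewrite -natrM mulnACA -expnD subnKC // -ltnS.
by [].
Qed.

(** Put r^{p+1} (A c_p + B c_{p+1}) into the recursion: the coefficients of c_{p+3} and c_{p+1}
    force B = -xr and A = 1 + 2B, and that of c_{p+2} then agrees. The equation for r is what the
    initial value W_0 = 1 amounts to. *)
Lemma disc_seriesE p : let x := fps_X in let r := tree_series in
  disc_series p = r ^+ p.+1 * ((1 - 2%:R * x * r) * catalan p - x * r * catalan p.+1).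
Proof.
move=> x r; have rE : r = 1 + 3%:R * (x * (r * r)) := tree_seriesE.
move: p; apply: disc_recursion_inj; first exact: disc_seriesS.
  move=> p; set A : fps rat := 1 - 2%:R * x * r; set B : fps rat := - (x * r).
  rewrite (eq_bigr (fun i : 'I_p.+1 => r ^+ p.+2 * (
      A * A * (catalan i * catalan (p - i)%N) + A * B * (catalan i * catalan (p - i).+1)
      + A * B * (catalan i.+1 * catalan (p - i)%N)
      + B * B * (catalan i.+1 * catalan (p - i).+1)))); last first.
    move=> i _; have -> : p.+2 = (i.+1 + (p - i).+1)%N by have := ltn_ord i; lia.
    rewrite exprD /B.
    move: (r ^+ i.+1) (r ^+ (p - i).+1) (catalan i) (catalan i.+1)
      (catalan (p - i)%N) (catalan (p - i).+1) (x * r) (A) => u v a a' b b' z A'.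
    by ring.
  rewrite -big_distrr !big_split /= -!big_distrr /=.
  rewrite -catalanS catalan_shift1 catalan_shift1' catalan_shift2 /A /B.
  by rewrite !exprS -/x; ring.
rewrite disc_series0 catalan0 catalanS big_ord1 catalan0 expr1.
by transitivity (r - 3%:R * (x * (r * r))); [rewrite {1}rE addrK | ring].
Qed.

Lemma quad_seriesE : let x := fps_X in let r := tree_series in
  quad_series = (x * r) ^+ 2 - 4%:R * (x * r) ^+ 3.
Proof.
move=> x r; transitivity (x * (x * disc_series 1%N)).
  apply: fpsP => -[|[|n]]; rewrite ?fps_XmulE //.
  by congr _%:R; rewrite nb_quadrangulationsE.
rewrite disc_seriesE (_ : catalan 2%N = 2%:R); last first.
  by rewrite catalanS !big_ord_recl big_ord0 /= catalanS big_ord1 catalan0; ring.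
by rewrite catalanS big_ord1 catalan0 -/x -/r; ring.
Qed.

(** With t = xr, pointing t = x + 3t^2 gives (1 - 6t) t' = x for the pointed series t', and pointing
    t^2 - 4t^3 gives 2t (1 - 6t) t'. The common factor removes t'. *)
Lemma pointed_quad_series :
  pointed quad_series = fps_X * (2%:R * (fps_X * tree_series)).
Proof.
set x := fps_X; set t := x * tree_series.
have tE : t = x + 3%:R * (t * t).
  by rewrite {1}/t tree_seriesE /t -/x; move: tree_series (x) => r y; ring.
have dt : pointed t - 6%:R * (t * pointed t) = x.
  rewrite {1}tE pointedD pointed_natmul pointedM pointedX -/x.
  by move: (t) (pointed t) (x) => u v y; ring.
have: quad_series + 4%:R * (t * (t * t)) = t * t.
  by rewrite quad_seriesE -/t; move: (t) => u; ring.
clearbody t; move/(congr1 pointed).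
rewrite pointedD pointed_natmul !pointedM => eqp.
transitivity (2%:R * t * (pointed t - 6%:R * (t * pointed t))).
  move/(canRL (addrK _)): eqp => ->.
  by move: (pointed t) => v; ring.
by rewrite dt; move: (t) (x) => u y; ring.
Qed.

Lemma quad_series_x2 : in_x2 quad_series.
Proof. by []. Qed.

Lemma quad_equation_quad_series : quad_equation quad_series.
Proof.
apply/(quad_equationE quad_series_x2); rewrite pointed_quad_series fps_XdivX.
rewrite quad_seriesE.
have := tree_seriesE; move: tree_series (fps_X : fps rat) => r x rE.
set t := x * r.
(* Eliminating x leaves a polynomial identity in t alone. *)
have -> : x = t - 3%:R * (t * t).
  by rewrite {1}/t {1}rE /t; ring.
ring.
Qed.

Theorem theorem1 :
  quad_equation quad_series
  /\ (forall F : fps rat, in_x2 F -> quad_equation F -> F = quad_series)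
  /\ quad_recursion (fun n => ((nb_quadrangulations n)%:R)%R)
  /\ (forall F : fps rat, in_x2 F -> (quad_equation F <-> quad_recursion F)).
Proof.
have rec : quad_recursion quad_series.
  exact/(quad_equation_recursion quad_series_x2)/quad_equation_quad_series.
split; first exact: quad_equation_quad_series.
split.
  move=> F x2F eqF; apply: quad_recursion_inj rec => //.
  exact/quad_equation_recursion.
split; last exact: quad_equation_recursion.
have [a2 a_rec] := rec; split=> // n n3.
(* The series is cut off below degree 2, but the recursion only involves indices from 2 on. *)
have qE k : (2 <= k)%N -> (nb_quadrangulations k)%:R = quad_series k :> rat.
  by rewrite /quad_series /= => ->.
rewrite !qE; try lia; rewrite a_rec //; congr (_ + _).
rewrite !big_nat; apply: eq_bigr => k /andP[k2 lt_k].
by rewrite !qE //; lia.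
Qed.
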